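(* Let $p\ge2$ be a constant and $0<\varepsilon<1$. In the distributed tracking model with $k$ sites, universe $[n]$ and total stream length $m=\mathrm{poly}(n)$, there is a tracking algorithm that, at any time $t$, with constant probability, outputs a $(1\pm\varepsilon)$-approximation of $F_p(t)=\sum_{j=1}^n v_j(t)^p$. Its communication cost is $O\!\left(\frac{k^{p-1}}{\varepsilon^2}\mathrm{polylog}(n)\right)$ bits.
   Context: Distributed tracking model: each site $i\in[k]$ receives over time a stream of items from $[n]$ (insertions only); $v_{ij}(t)$ is the count of $j$ at site $i$ up to time $t$ and $v_j(t)=\sum_{i=1}^k v_{ij}(t)$. The coordinator must maintain an estimate at every time step; communication cost is the total number of bits exchanged between the coordinator and the sites over the whole stream. A $(1\pm\varepsilon)$-approximation of $F$ is a value $\hat F$ with $|\hat F-F|\le\varepsilon F$. *)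

(* Defs.v *)
From mathcomp Require Import all_boot all_order all_algebra.
From mathcomp Require Import reals exp.

Set Implicit Arguments.
Unset Strict Implicit.
Unset Printing Implicit Defensive.

Import Order.TTheory GRing.Theory Num.Theory.
Local Open Scope ring_scope.

(* A stream lists the arrivals in time order: its t-th entry (i, j) says that,
   at time t, item j arrives at site i. The input "up to time t"
   is thus the prefix [take t s]. *)
Definition stream (k n : nat) := seq ('I_k * 'I_n).

Definition site_count k n (s : stream k n) (i : 'I_k) (j : 'I_n) : nat :=
  count_mem (i, j) s.

Definition freq k n (s : stream k n) (j : 'I_n) : nat :=
  (\sum_(i < k) site_count s i j)%N.

Definition moment (R : realType) (p : R) k n (s : stream k n) : R :=
  \sum_(j < n) (freq s j)%:R `^ p.

Definition approximates (R : realType) (eps F Fhat : R) : bool :=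
  `|Fhat - F| <= eps * F.

(* A tracking protocol for k sites and one coordinator. Messages are bit
   strings, and the empty string means "no message": it costs nothing, and a
   party that is sent nothing is not activated, so that no information can
   travel for free in empty messages. Parties are reactive: a site acts only
   upon an arrival or a message from the coordinator, and the coordinator only
   upon messages from the sites (and once before the stream starts); in
   particular they do not observe the global clock or the arrivals elsewhere.
   Each party is given its own private seed; the state types are arbitrary, as
   only communication is charged for.
   [rounds] caps the number of round trips in the exchange that follows each
   arrival; see [terminating] below. *)
Record protocol (R : realType) (k n : nat) := Protocol {
  seed : finType;
  site_state : Type;
  coord_state : Type;
  rounds : nat;
  site_init : 'I_k -> seed -> site_state;
  coord_init : seed -> coord_state * {ffun 'I_k -> bitseq};
  on_item : site_state -> 'I_n -> site_state * bitseq;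
  on_down : site_state -> bitseq -> site_state * bitseq;
  on_up : coord_state -> {ffun 'I_k -> bitseq} ->
          coord_state * {ffun 'I_k -> bitseq};
  estimate : coord_state -> R
}.

Section Execution.
Variables (R : realType) (k n : nat) (P : protocol R k n).

(* One seed per party, [None] being the coordinator. *)
Definition coins := {ffun option 'I_k -> seed P}.

(* [up] holds the messages sent by the sites and not yet delivered to the
   coordinator, and [bits] the number of bits delivered so far, in both
   directions; a broadcast is charged once per recipient. *)
Record config := Config {
  sites : {ffun 'I_k -> site_state P};
  coordinator : coord_state P;
  up : {ffun 'I_k -> bitseq};
  bits : nat
}.

Definition quiet (c : config) : bool := [forall i, nilp (up c i)].

Definition send_down (st : {ffun 'I_k -> site_state P}) (x : coord_state P)
    (d : {ffun 'I_k -> bitseq}) (b : nat) : config :=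
  let r i := if nilp (d i) then (st i, [::]) else on_down (st i) (d i) in
  Config [ffun i => (r i).1] x [ffun i => (r i).2]
         (b + \sum_(i < k) size (d i))%N.

Definition round (c : config) : config :=
  if quiet c then c else
  let: (x, d) := on_up (coordinator c) (up c) in
  send_down (sites c) x d (bits c + \sum_(i < k) size (up c i))%N.

Definition settle (c : config) : config := iter (rounds P) round c.

Definition start (w : coins) : config :=
  let: (x, d) := coord_init (w None) in
  settle (send_down [ffun i => site_init i (w (Some i))] x d 0).

Definition arrive (c : config) (a : 'I_k * 'I_n) : config :=
  let: (s', b) := on_item (sites c a.1) a.2 in
  Config [ffun i => if i == a.1 then s' else sites c i] (coordinator c)
         [ffun i => if i == a.1 then b else [::]] (bits c).

(* Communication is instantaneous: the exchange triggered by an arrival is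
   carried out before the next arrival. *)
Definition run (w : coins) (s : stream k n) : config :=
  foldl (fun c a => settle (arrive c a)) (start w) s.

Definition output (w : coins) (s : stream k n) : R := estimate (coordinator (run w s)).

(* Total communication, in bits, over the whole stream. *)
Definition cost (w : coins) (s : stream k n) : nat := bits (run w s).

(* Every exchange on a stream of length m really ends within the allotted
   number of rounds, i.e. the cap never cuts off a pending message. *)
Definition terminating (m : nat) : Prop :=
  forall (w : coins) (s : m.-tuple ('I_k * 'I_n)) (t : nat),
    (t <= m)%N -> quiet (run w (take t s)).

(* Seeds are uniform, hence uniform and mutually independent per party. *)
Definition Pr (E : pred coins) : R := #|E|%:R / #|{: coins}|%:R.

End Execution.

(* Main.v *)
(* Fix a scale 2^g as a guess for F_p and put tau = eps^2 2^g / polylog. Each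
   v_j^p / tau is rounded to one of its two neighbouring integers A_j(v_j), the
   rounding being driven by a pairwise independent hash that the coordinator
   broadcasts once. Then tau * sum_j A_j(v_j) is an (almost) unbiased estimate
   of F_p with variance at most tau * F_p, so it suffices to know when v_j
   crosses the random points at which the step function A_j jumps.

   Let T be the first jump of A_j. Each site ignores its first T / 2k copies of
   j and then reports an arrival of j with probability about lam / T; at the
   second report the coordinator polls all sites for v_j. If v_j >= T, at least
   T / 2 arrivals are eligible, so fewer than two reports are unlikely. If
   v_j = X T, a poll has probability O(lam^2 X^2) and is possible only when
   X >= 1 / 2k, so its expected cost is k X^2 = O(k^(p-1) X^p) up to
   logarithms; averaging X^p over the random T gives O(log n) v_j^p / tau. After
   the first poll, later jumps are detected deterministically: the sites
   signal every gap / 4k arrivals, and each poll halves the gap or passes a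
   jump, so that a jump costs O(k log n) messages, while E sum_j A_j(v_j) is at
   most F_p / tau = polylog / eps^2.

   All O(log n) scales run in parallel. The coordinator halts a scale that
   exceeds its budget and answers with the least scale still running: every
   scale below the right one is even more accurate, as long as it runs. *)

Require Import Defs.
From mathcomp Require Import all_boot all_order all_algebra.
From mathcomp Require Import reals exp.
From mathcomp Require Import all_field sequences.
From mathcomp Require Import zify ring lra.

Set Implicit Arguments.
Unset Strict Implicit.
Unset Printing Implicit Defensive.

Import Order.TTheory GRing.Theory Num.Theory.
Local Open Scope nat_scope.

(** * Monitoring the jumps of a step function *)

Section ThresholdMonitoring.
Variables (m : nat) (A : nat -> nat).
Hypothesis A_mono : {homo A : x y / x <= y}.

(* The value is [m.+1] if [A] is constant on [B, m]. *)
Definition next_jump (B : nat) : nat :=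
  B.+1 + find (fun t => A B < A t) (iota B.+1 (m - B)).

Definition gap (B : nat) : nat := next_jump B - B.

Lemma next_jump_gt B : B < next_jump B.
Proof. rewrite /next_jump; lia. Qed.

Lemma next_jump_le B : B <= m -> next_jump B <= m.+1.
Proof.
move=> Bm; have := find_size (fun t => A B < A t) (iota B.+1 (m - B)).
rewrite size_iota /next_jump; lia.
Qed.

Lemma before_jump B v : B <= v < next_jump B -> A v = A B.
Proof.
case/andP=> Bv vN; case: (ltngtP B v) Bv => // [Bv _|-> //].
have Hf : v - B.+1 < find (fun t => A B < A t) (iota B.+1 (m - B)).
  by move: vN; rewrite /next_jump; lia.
have := before_find 0 Hf; rewrite nth_iota; last first.
  by have := find_size (fun t => A B < A t) (iota B.+1 (m - B)); rewrite size_iota; lia.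
rewrite subnKC // => /negbT; rewrite -leqNgt => H.
by apply/eqP; rewrite eqn_leq H A_mono // ltnW.
Qed.

Lemma after_jump B v : next_jump B <= m -> next_jump B <= v -> A B < A v.
Proof.
move=> Nm Nv; apply: leq_trans (A_mono Nv).
have Hf : find (fun t => A B < A t) (iota B.+1 (m - B)) < m - B.
  by move: Nm; rewrite /next_jump; lia.
have Hh : has (fun t => A B < A t) (iota B.+1 (m - B)).
  by rewrite has_find size_iota.
by have := nth_find 0 Hh; rewrite nth_iota.
Qed.

Lemma gap_gt0 B : 0 < gap B.
Proof. by rewrite subn_gt0 next_jump_gt. Qed.

(** The shift by one keeps [lg] positive. The potential below needs this when a poll passes a
    jump. *)
Definition lg (x : nat) : nat := (trunc_log 2 x).+1.

Lemma lg_halved x y : 0 < x -> 2 * x <= y -> lg x < lg y.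
Proof.
move=> x0 xy; rewrite /lg ltnS -trunc_log2_double //; apply: leq_trunc_log.
by rewrite -mul2n.
Qed.

Lemma lg_gap B X : B <= m -> m.+1 <= 2 ^ X -> lg (gap B) <= X.+1.
Proof.
move=> Bm mX; rewrite ltnS -[X in _ <= X](@trunc_expnK 2) //.
apply: leq_trunc_log; apply: leq_trans mX.
have := next_jump_le Bm; rewrite /gap; lia.
Qed.

Variable k : nat.
Hypothesis k_gt0 : 0 < k.

(* Let each site signal every [quota] arrivals. As long as fewer than [alarm]
   signals were sent since the total count was [B], the next jump is not reached
   even if every site holds back [quota - 1] further arrivals. *)
Definition quota (B : nat) : nat := maxn 1 (gap B %/ (4 * k)).

Definition alarm (B : nat) : nat :=
  (gap B - k * (quota B).-1 + (quota B).-1) %/ quota B.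

Lemma quota_gt0 B : 0 < quota B.
Proof. by rewrite leq_max. Qed.

(** The arrivals that the sites can hold back amount to at most a quarter of the gap. When the quota
    is [1], nothing is held back. *)
Lemma quota_le B : 4 * (k * (quota B).-1) <= gap B.
Proof.
rewrite /quota; case: (leqP (gap B %/ (4 * k)) 1) => H.
  by rewrite muln0 muln0.
apply: leq_trans (leq_divM (gap B) (4 * k)).
by rewrite mulnA [_ %/ _ * _]mulnC leq_mul // leq_pred.
Qed.

(** [alarm] is a quotient rounded up, so staying below it means exactly that all signalled arrivals,
    plus the most that can be held back, fit strictly inside the gap. *)
Lemma alarm_lt B s :
  (s < alarm B) = (quota B * s + k * (quota B).-1 < gap B).
Proof.
have q0 := quota_gt0 B; have := quota_le B; have := gap_gt0 B.
rewrite /alarm; set Y := gap B; set q := quota B in q0 *.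
move=> Y0 qY.
have -> : (s < (Y - k * q.-1 + q.-1) %/ q) = (s.+1 * q <= Y - k * q.-1 + q.-1).
  by rewrite leq_divRL.
rewrite mulSn [s * q]mulnC.
by apply/idP/idP; move: (q * s) (k * q.-1) qY => x y; lia.
Qed.

Lemma alarm_gt0 B : 0 < alarm B.
Proof.
rewrite alarm_lt muln0; have := quota_le B; have := gap_gt0 B.
move: (k * _) => x; lia.
Qed.

(** At [alarm B] signals the previous bound fails, and at most a quarter of the gap is unsignalled,
    so the signals cover three quarters of it. *)
Lemma alarm_ge_half B : gap B <= 2 * (quota B * alarm B).
Proof.
have := alarm_lt B (alarm B); rewrite ltnn => /esym/negbT; rewrite -leqNgt.
have := quota_le B; move: (k * _) (quota B * _) => x y; lia.
Qed.

(** The gap is below [4 * k * (quota B).+1], which is at most [8 * k] quotas. *)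
Lemma alarm_le B : alarm B <= 8 * k.
Proof.
rewrite leqNgt alarm_lt -leqNgt.
have := quota_gt0 B.
have H : gap B < 4 * k * (quota B).+1.
  rewrite mulnC -ltn_divLR; last by lia.
  by rewrite /quota; lia.
move: H; set q := quota B; move=> H q0; nia.
Qed.

(** No jump lies between [B] and [v], so both have the same next jump, and the arrivals since [B]
    already cover half of the way to it. *)
Lemma gap_halved B v : B <= m -> B + quota B * alarm B <= v -> v < next_jump B ->
  2 * gap v <= gap B.
Proof.
move=> Bm Hv vN.
have Bv : B <= v by lia.
have Av : A v = A B by apply: before_jump; rewrite Bv.
have Hn : next_jump v = next_jump B.
  have vm : v <= m by have := next_jump_le Bm; lia.
  apply/eqP; rewrite eqn_leq; apply/andP; split; rewrite leqNgt; apply/negP => H.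
    have Bm' : next_jump B <= m by have := next_jump_le vm; lia.
    have := after_jump Bm' (leqnn _).
    have -> : A (next_jump B) = A v by apply: before_jump; rewrite (ltnW vN).
    by rewrite Av ltnn.
  have vm' : next_jump v <= m by have := next_jump_le Bm; lia.
  have := after_jump vm' (leqnn _).
  have -> : A (next_jump v) = A B.
    by apply: before_jump; rewrite H andbT; have := next_jump_gt v; lia.
  by rewrite Av ltnn.
have := alarm_ge_half B; rewrite /gap Hn; lia.
Qed.

End ThresholdMonitoring.

(** * The protocol *)

Section Encoding.
Variables (T : finType) (l : nat).

(** A fixed-length code by rank. The default word can only arise when [T] has more than [2 ^ l]
    elements, which [encodeK] excludes. *)
Definition encode (x : T) : bitseq :=
  nth (nseq_tuple l false) (enum {: l.-tuple bool}) (enum_rank x).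

Definition decode (b : bitseq) : option T := [pick x | encode x == b].

Lemma size_encode x : size (encode x) = l.
Proof. by rewrite size_tuple. Qed.

Lemma encodeK : #|T| <= 2 ^ l -> pcancel encode decode.
Proof.
move=> Tl x; rewrite /decode; case: pickP => [y /eqP|/(_ x)]; last by rewrite eqxx.
have lt (z : T) : enum_rank z < size (enum {: l.-tuple bool}).
  rewrite -cardE card_tuple card_bool. exact: leq_trans (ltn_ord _) Tl.
move=> E; have /eqP := val_inj E; rewrite nth_uniq ?enum_uniq //.
by move=> /eqP/val_inj/enum_rank_inj ->.
Qed.

End Encoding.

Section Counts.
Variables (k n : nat).

Lemma site_count_rcons (s : stream k n) (a : 'I_k * 'I_n) i j :
  site_count (rcons s a) i j = site_count s i j + (a == (i, j)).
Proof. by rewrite /site_count -cats1 count_cat /= addn0. Qed.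

Lemma freq_rcons (s : stream k n) (a : 'I_k * 'I_n) j :
  freq (rcons s a) j = freq s j + (a.2 == j).
Proof.
rewrite /freq; under eq_bigr do rewrite site_count_rcons.
rewrite big_split /=; congr (_ + _); case: a => i0 j0 /=.
under eq_bigr do rewrite xpair_eqE andbC.
case: (j0 == j) => /=; last by rewrite big1.
by rewrite (bigD1 i0) //= eqxx big1 ?addn0 // => i; rewrite eq_sym => /negbTE ->.
Qed.

Lemma freq_size (s : stream k n) j : freq s j <= size s.
Proof.
elim/last_ind: s => [|s a IH]; first by rewrite /freq big1.
by rewrite freq_rcons size_rcons -addn1 leq_add // leq_b1.
Qed.

Lemma site_count_freq (s : stream k n) i j : site_count s i j <= freq s j.
Proof. by rewrite /freq (bigD1 i) //= leq_addr. Qed.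

End Counts.

(** * States, messages and reactions of the parties *)

Section Protocol.
Variables (R : realType) (k n m G l : nat) (hash : finType).
Variables (A : hash -> 'I_G -> 'I_n -> nat -> nat) (lam Bud : nat) (tau : 'I_G -> R).

(** One coin per scale, item and local count, drawn in advance: whether an arrival is a hit then
    depends on seeds and input only, not on earlier communication. *)
Definition key := ('I_G * 'I_n * 'I_m.+1)%type.
Definition coin := 'I_m.+1.
Definition party_seed := (hash * {ffun key -> coin})%type.

(** Upwards: a signal (an item with all scales at which it is due) or a local count. Downwards: the
    hash, a poll request ([None]), or the outcome of a poll with the polled and the halted
    scales. *)
Definition up_msg := ('I_n * {set 'I_G} + 'I_m.+1)%type.
Definition down_msg :=
  (hash + 'I_n * option ('I_m.+1 * {set 'I_G} * {set 'I_G}))%type.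

Definition first_jump h g j := next_jump m (A h g j) 0.

(* Hiding [offset] arrivals per site hides at most half of [first_jump] in total,
   and any visible arrival certifies a count of at least [first_jump / 2k]. *)
Definition offset h g j :=
  if first_jump h g j <= lam then 0 else first_jump h g j %/ (2 * k).

(* Waiting for a second hit makes the probability of a premature poll quadratic in
   the count, which compensates for the [k] messages of a poll. A jump below [lam]
   is cheap to monitor exactly: there every arrival is a hit. *)
Definition hits_needed h g j := if first_jump h g j <= lam then 1 else 2.

(** For [u] uniform below [m.+1] this has probability about [lam / first_jump], stated without
    division. *)
Definition hit h g j (u : coin) := u * first_jump h g j < lam * m.+1.

(** The value [m.+1] of [first_jump] means that no jump occurs within the stream, and then nothing
    is reported. *)
Definition watched h g j v := (first_jump h g j <= m) && (offset h g j < v).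

(* [site_base] is [None] before the first poll for the item at that scale, and then
   holds the local and the total count at the last poll. *)
Record site := Site {
  site_hash : hash;
  site_coins : {ffun key -> coin};
  site_cnt : {ffun 'I_n -> nat};
  site_base : {ffun 'I_G * 'I_n -> option (nat * nat)};
  site_halted : {set 'I_G}
}.

Record coord := Coord {
  coord_hash : hash;
  signals : {ffun 'I_G * 'I_n -> nat};
  base : {ffun 'I_G * 'I_n -> option nat};
  charge : {ffun 'I_G * 'I_n -> nat};
  halted : {set 'I_G};
  pending : option ('I_n * {set 'I_G} * {set 'I_G})
}.

Definition signal_due (h : hash) g j (cnt : nat) (u : coin) (b : option (nat * nat)) :=
  match b with
  | None => watched h g j cnt && hit h g j u
  | Some (c, B) => quota m (A h g j) k B %| cnt - c
  end.

Definition needed h g j (B : option nat) :=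
  if B is Some B then alarm m (A h g j) k B else hits_needed h g j.

Definition tick (st : site) (j : 'I_n) : site * bitseq :=
  let cnt := (site_cnt st j).+1 in
  let due := [set g | (g \notin site_halted st) &&
    signal_due (site_hash st) g j cnt (site_coins st (g, j, inord cnt))
      (site_base st (g, j))] in
  (Site (site_hash st) (site_coins st)
     [ffun j' => if j' == j then cnt else site_cnt st j']
     (site_base st) (site_halted st),
   if due == set0 then [::] else encode l (inl (j, due) : up_msg)).

Definition obey (st : site) (b : bitseq) : site * bitseq :=
  match decode down_msg l b with
  | Some (inl h) =>
      (Site h (site_coins st) (site_cnt st) (site_base st) (site_halted st), [::])
  | Some (inr (j, None)) => (st, encode l (inr (inord (site_cnt st j)) : up_msg))
  | Some (inr (j, Some (B, Q, H))) =>
      (Site (site_hash st) (site_coins st) (site_cnt st)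
         [ffun e => if (e.1 \in Q) && (e.2 == j)
                    then Some (site_cnt st j, B : nat) else site_base st e]
         (site_halted st :|: H), [::])
  | None => (st, [::])
  end.

Definition silence : {ffun 'I_k -> bitseq} := [ffun => [::]].

Definition signals_after (x : coord) j (due : {set 'I_G}) : {ffun 'I_G * 'I_n -> nat} :=
  [ffun e => signals x e + ((e.1 \in due) && (e.2 == j))].

Definition polled (x : coord) j (due : {set 'I_G}) : {set 'I_G} :=
  [set g in due | needed (coord_hash x) g j (base x (g, j)) <= (signals x (g, j)).+1].

(** The unit is one message of [l] bits. A poll costs [3 * k]: requests, replies and the broadcast
    of the result. *)
Definition charge_after (x : coord) j (due : {set 'I_G}) : {ffun 'I_G * 'I_n -> nat} :=
  [ffun e => charge x e +
     (e.2 == j) * ((e.1 \in due) + 3 * k * (e.1 \in polled x j due))].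

Definition overspent (x : coord) j (due : {set 'I_G}) : {set 'I_G} :=
  [set g in due | Bud < \sum_i charge_after x j due (g, i)].

(* [Q] are the scales to be polled, [H] those to be halted. The same exchange serves
   both: the coordinator asks for the local counts of [j], then broadcasts their
   sum together with [Q] and [H]. *)
Definition handle (x : coord) (j : 'I_n) (due : {set 'I_G}) :
    coord * {ffun 'I_k -> bitseq} :=
  let Q := polled x j due in
  let H := overspent x j due in
  let c := [ffun e => charge_after x j due e + (e.2 == j) * (3 * k * (e.1 \in H))] in
  let idle := Q :|: H == set0 in
  (Coord (coord_hash x) (signals_after x j due) (base x) c (halted x)
     (if idle then None else Some (j, Q, H)),
   if idle then silence else [ffun => encode l (inr (j, None) : down_msg)]).

Definition collect (x : coord) j (Q H : {set 'I_G}) (B : nat) :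
    coord * {ffun 'I_k -> bitseq} :=
  (Coord (coord_hash x)
     [ffun e => if (e.1 \in Q) && (e.2 == j) then 0 else signals x e]
     [ffun e => if (e.1 \in Q) && (e.2 == j) then Some B else base x e]
     (charge x) (halted x :|: H) None,
   [ffun => encode l (inr (j, Some (inord B, Q, H)) : down_msg)]).

Definition reported (b : bitseq) : nat :=
  if decode up_msg l b is Some (inr c) then c else 0.

Definition listen (x : coord) (u : {ffun 'I_k -> bitseq}) :
    coord * {ffun 'I_k -> bitseq} :=
  match pending x with
  | Some (j, Q, H) => collect x j Q H (\sum_i reported (u i))
  | None =>
      if [pick i | ~~ nilp (u i)] is Some i then
        if decode up_msg l (u i) is Some (inl (j, due)) then handle x j due
        else (x, silence)
      else (x, silence)
  end.

Definition tally (x : coord) g j : nat :=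
  if base x (g, j) is Some B then A (coord_hash x) g j B else 0.

Definition answer (x : coord) : R :=
  if [pick g | (g \notin halted x) && [forall g' : 'I_G, (g' < g) ==> (g' \in halted x)]]
    is Some g then (tau g * (\sum_j tally x g j)%:R)%R else 0%R.

Definition tracker : protocol R k n := {|
  seed := party_seed;
  site_state := site;
  coord_state := coord;
  rounds := 2;
  site_init := fun _ w => Site w.1 w.2 [ffun => 0] [ffun => None] set0;
  coord_init := fun w =>
    (Coord w.1 [ffun => 0] [ffun => None] [ffun => 0] set0 None,
     [ffun => encode l (inl w.1 : down_msg)]);
  on_item := tick;
  on_down := obey;
  on_up := listen;
  estimate := answer |}.

(** * The exact effect of one exchange *)

Hypotheses (k_gt0 : 0 < k) (l_gt0 : 0 < l).
Hypotheses (card_up : #|{: up_msg}| <= 2 ^ l) (card_down : #|{: down_msg}| <= 2 ^ l).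

Lemma nilp_encode (T : finType) (x : T) : nilp (encode l x) = false.
Proof. by rewrite /nilp size_encode; case: l l_gt0. Qed.

Record coherent (w : coins tracker) (s : stream k n) (c : config tracker) : Prop := {
  up_silent : up c = silence;
  not_pending : pending (coordinator c) = None;
  coord_hashE : coord_hash (coordinator c) = (w None).1;
  site_hashE : forall i, site_hash (sites c i) = (w None).1;
  site_coinsE : forall i, site_coins (sites c i) = (w (Some i)).2;
  site_haltedE : forall i, site_halted (sites c i) = halted (coordinator c);
  site_cntE : forall i j, site_cnt (sites c i) j = site_count s i j
}.

Definition due_set (w : coins tracker) s (c : config tracker) i j : {set 'I_G} :=
  [set g | (g \notin halted (coordinator c)) &&
    signal_due (w None).1 g j (site_count s i j)
      ((w (Some i)).2 (g, j, inord (site_count s i j))) (site_base (sites c i) (g, j))].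

Lemma round_silent y z b :
  round (@Config _ _ _ tracker y z silence b) = Config y z silence b.
Proof. by rewrite /round ifT //; apply/forallP => i; rewrite ffunE. Qed.

(** At most two rounds take place: a signal answered by poll requests, then local counts answered by
    the result. Collecting with empty [Q] and [H] changes nothing, so a single formula also covers
    the exchanges that stop earlier. *)
Lemma settle_arrive w s c i j : coherent w s c -> size s < m ->
  let x := coordinator c in
  let s' := rcons s (i, j) in
  let due := due_set w s' c i j in
  let Q := polled x j due in
  let H := overspent x j due in
  exists2 b, settle (arrive c (i, j)) =
    @Config _ _ _ tracker
      [ffun i' => Site (w None).1 (w (Some i')).2 [ffun j' => site_count s' i' j']
         [ffun e => if (e.1 \in Q) && (e.2 == j)
                    then Some (site_count s' i' j, freq s' j)
                    else site_base (sites c i') e]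
         (halted x :|: H)]
      (collect (handle x j due).1 j Q H (freq s' j)).1 silence b
  & b <= bits c + l * (due != set0) + 3 * k * l * (Q :|: H != set0).
Proof.
move=> [upE pE hE shE scE shaE cntE] sm x s' due Q H.
have ltcnt i' : site_count s' i' j <= m.
  by apply: leq_trans (site_count_freq _ _ _) _; apply: leq_trans (freq_size _ _) _; rewrite size_rcons.
have ltfreq : freq s' j <= m by apply: leq_trans (freq_size _ _) _; rewrite size_rcons.
pose st1 i' : site := Site (w None).1 (w (Some i')).2 [ffun j' => site_count s' i' j']
   (site_base (sites c i')) (halted x).
have dueE : due = [set g | (g \notin site_halted (sites c i)) &&
    signal_due (site_hash (sites c i)) g j (site_cnt (sites c i) j).+1
     (site_coins (sites c i) (g, j, inord (site_cnt (sites c i) j).+1))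
      (site_base (sites c i) (g, j))].
  by apply/setP => g; rewrite !inE shaE shE scE cntE site_count_rcons eqxx addn1.
have arrE : arrive c (i, j) = @Config _ _ _ tracker [ffun i' => st1 i'] x
  [ffun i' => if (i' == i) && (due != set0) then encode l (inl (j, due) : up_msg) else [::]] (bits c).
  rewrite /arrive /= -dueE; congr Config.
    apply/ffunP => i'; rewrite !ffunE /st1; case: eqP => [->|ne].
      rewrite shE scE shaE; congr Site; apply/ffunP => j'; rewrite !ffunE site_count_rcons !cntE.
      by rewrite xpair_eqE eqxx /= [j == j']eq_sym; case: eqP => [->|]; rewrite ?addn1 ?addn0.
    case E : (sites c i') (shE i') (scE i') (shaE i') (cntE i') => [a1 a2 a3 a4 a5] /= -> -> -> H3.
    congr Site; apply/ffunP => j'; rewrite ffunE H3 site_count_rcons xpair_eqE.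
    have/negbTE -> : i != i' by apply/eqP => eii; apply: ne; rewrite eii.
    by rewrite addn0.
  by apply/ffunP => i'; rewrite !ffunE; case: eqP; case: eqP.
rewrite arrE /settle /=; clear arrE.
have [due0|due1] := eqVneq due set0.
  have Q0 : Q = set0 by apply/setP => g; rewrite /Q /polled due0 !inE.
  have H0 : H = set0 by apply/setP => g; rewrite /H /overspent due0 !inE.
  exists (bits c); last by rewrite -addnA leq_addr.
  rewrite due0.
  have -> : [ffun i' : 'I_k => if (i' == i) && ~~ true
      then encode l (inl (j, set0) : up_msg) else [::]] = silence.
    by apply/ffunP => i'; rewrite !ffunE andbF.
  rewrite !round_silent; congr Config.
    apply/ffunP => i'; rewrite !ffunE /st1 H0 setU0; congr Site.
    by apply/ffunP => e; rewrite !ffunE Q0 inE.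
  have coordE (y : coord) :
    y = Coord (coord_hash y) (signals y) (base y) (charge y) (halted y) (pending y) by case: y.
  have O0 : overspent x j set0 = set0 by apply/setP => g; rewrite !inE.
  rewrite [LHS]coordE pE /= H0 setU0; congr Coord; apply/ffunP => e; rewrite !ffunE ?Q0 !inE //=.
    by rewrite addn0.
  by rewrite !(muln0, addn0).
have pickE : [pick i' | ~~ nilp ([ffun i' : 'I_k => if (i' == i) && ~~ false
    then encode l (inl (j, due) : up_msg) else [::]] i')] = Some i.
  case: pickP => [i'|/(_ i)]; rewrite !ffunE; last by rewrite eqxx nilp_encode.
  by case: eqP => [->|].
rewrite {2}/round ifF; last first.
  by apply/negP => /forallP /(_ i); rewrite ffunE eqxx nilp_encode.
rewrite [on_up _]/= /listen /= pE pickE ffunE eqxx encodeK //.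
have sizeE : \sum_(i' < k) size ([ffun i' : 'I_k => if (i' == i) && ~~ false
    then encode l (inl (j, due) : up_msg) else [::]] i') = l.
  rewrite (bigD1 i) //= ffunE eqxx size_encode big1 ?addn0 // => i' /negbTE ne.
  by rewrite ffunE ne.
rewrite /= in sizeE; rewrite sizeE.
have silE : \sum_(i' < k) size (silence i') = 0 by apply: big1 => i' _; rewrite ffunE.
rewrite [handle x j due]/handle -/Q -/H.
have [QH0|QH1] := eqVneq (Q :|: H) set0.
  rewrite /send_down silE /round ifT; last first.
    by apply/forallP => i' /=; rewrite !ffunE.
  exists (bits c + l + 0); last by lia.
  move: QH0 => /eqP; rewrite setU_eq0 => /andP[/eqP Q0 /eqP H0].
  congr Config.
  - apply/ffunP => i'; rewrite !ffunE /st1 H0 setU0; congr Site.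
    by apply/ffunP => e; rewrite !ffunE Q0 inE.
  - rewrite /collect /= H0 setU0 Q0; congr Coord; apply/ffunP => e; rewrite !ffunE in_set0 //.
  - by apply/ffunP => i'; rewrite !ffunE.
set x1 := Coord _ _ _ _ _ _.
set d1 := [ffun _ => encode l (inr (j, None) : down_msg)].
have sized (y : down_msg) : \sum_(i' < k) size ([ffun _ : 'I_k => encode l y] i') = k * l.
  by under eq_bigr do rewrite ffunE size_encode; rewrite sum_nat_const card_ord.
have pollE b : @send_down _ _ _ tracker [ffun i' => st1 i'] x1 d1 b =
    @Config _ _ _ tracker [ffun i' => st1 i'] x1
      [ffun i' => encode l (inr (inord (site_count s' i' j)) : up_msg)] (b + k * l).
  rewrite /send_down sized; congr Config; apply/ffunP => i'; rewrite !ffunE nilp_encode //=.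
    by rewrite /obey encodeK.
  by rewrite /obey encodeK //= ffunE.
rewrite pollE /round ifF; last first.
  by apply/negP => /forallP /(_ i); rewrite ffunE nilp_encode.
have reportE : \sum_(i' < k) reported 
   ([ffun i' => encode l (inr (inord (site_count s' i' j)) : up_msg)] i') = freq s' j.
  rewrite /freq; apply: eq_bigr => i' _.
  by rewrite ffunE /reported encodeK // inordK ?ltnS ?ltcnt.
rewrite [up _]/= [bits _]/= [sites _]/= reportE.
have sizec : \sum_(i' < k) size ([ffun i' : 'I_k =>
    encode l (inr (inord (site_count s' i' j)) : up_msg)] i') = k * l.
  by under eq_bigr do rewrite ffunE size_encode; rewrite sum_nat_const card_ord.
rewrite sizec /send_down sized.
exists (bits c + l + k * l + k * l + k * l); last by lia.
congr Config; apply/ffunP => i'; rewrite !ffunE nilp_encode //= /obey encodeK //=.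
congr Site; apply/ffunP => e; rewrite !ffunE /= inordK //.
Qed.

(** * The invariant of a run and a bound on the charge of each scale *)

Variable X : nat.
Hypotheses (lam_gt0 : 0 < lam) (m_lt : m.+1 <= 2 ^ X).
Hypotheses (A_mono : forall h g j, {homo A h g j : x y / x <= y}).

Definition window h g j (s : stream k n) : {set 'I_k * key} :=
  [set e : 'I_k * key | (e.2.1 == (g, j)) && (watched h g j e.2.2 && (e.2.2 <= site_count s e.1 j))].

(** Hits are counted also past the first poll, when the sites no longer report them. This makes the
    count independent of the execution. *)
Definition hits (w : coins tracker) g j s : nat :=
  \sum_(e in window (w None).1 g j s) hit (w None).1 g j ((w (Some e.1)).2 e.2).

Lemma hits_other w g i j j' s : j != j' -> hits w g j' (rcons s (i, j)) = hits w g j' s.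
Proof.
move=> jj; apply: eq_bigl => e; rewrite !inE site_count_rcons xpair_eqE (negbTE jj).
by rewrite andbF addn0.
Qed.

Lemma hits_rcons w g i j s : size s < m ->
  let cnt := site_count (rcons s (i, j)) i j in
  hits w g j (rcons s (i, j)) = hits w g j s +
    (watched (w None).1 g j cnt && hit (w None).1 g j ((w (Some i)).2 (g, j, inord cnt))).
Proof.
move=> sm; set s' := rcons s (i, j) => /=; set cnt := site_count s' i j.
have cntm : cnt <= m.
  by apply: leq_trans (site_count_freq _ _ _) _; apply: leq_trans (freq_size _ _) _; rewrite size_rcons.
have cntE : cnt = (site_count s i j).+1 by rewrite /cnt site_count_rcons eqxx addn1.
pose e0 : 'I_k * key := (i, (g, j, inord cnt)).
have winE e : (e \in window (w None).1 g j s') = (e \in window (w None).1 g j s) ||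
    ((e == e0) && watched (w None).1 g j cnt).
  case: e => i' [[g' j'] v]; rewrite !inE /= site_count_rcons !xpair_eqE eqxx andbT.
  have -> : (v == inord cnt) = (v == cnt :> nat) by rewrite -val_eqE /= inordK.
  case: (g' == g); case: (j' == j) => //=; rewrite ?andbF //= [i == i']eq_sym.
  case: (i' =P i) => [->|_] /=; last by rewrite addn0 orbF.
  rewrite cntE; case: (v =P _ :> nat) => [->|ne] /=.
    by rewrite addn1 leqnn andbT orbC; case: watched.
  rewrite orbF; congr (_ && _); apply/idP/idP; lia.
have e0s : e0 \notin window (w None).1 g j s.
  by rewrite !inE /= inordK // cntE ltnn !andbF.
rewrite /hits; case W: (watched _ _ _ _) => /=; last first.
  by rewrite addn0; apply: eq_bigl => e; rewrite winE W andbF orbF.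
rewrite (bigD1 e0) /=; last by rewrite winE eqxx W orbT.
rewrite addnC; congr (_ + _); apply: eq_bigl => e; rewrite winE W andbT.
by case: eqP => [->|_]; rewrite ?orbT ?orbF ?andbT // (negbTE e0s).
Qed.

(* Bounds the number of polls after the first one: each poll halves the gap or
   passes a jump. *)
Definition potential h g j B := A h g j B * X.+1 + (X.+1 - lg (gap m (A h g j) B)).

(** Once a poll has taken place, [c i] is the local count of site [i] at the last one. In the bound
    on [ch], [5 * k] pays for the first poll and the at most two hits leading to it; each unit of
    potential pays [12 * k] for a later poll, namely [3 * k] messages and at most [8 * k]
    signals. *)
Definition tracking (w : coins tracker) (s : stream k n) g j
    (B : option nat) (b : 'I_k -> option (nat * nat)) (sg ch : nat) : Prop :=
  match B with
  | None => [/\ forall i, b i = None, sg = hits w g j s,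
      hits w g j s < hits_needed (w None).1 g j & ch = hits w g j s]
  | Some B => exists2 c : 'I_k -> nat,
      (forall i, b i = Some (c i, B) /\ c i <= site_count s i j) &
      [/\ B = \sum_i c i,
      sg = \sum_i (site_count s i j - c i) %/ quota m (A (w None).1 g j) k B,
      sg < alarm m (A (w None).1 g j) k B,
      hits_needed (w None).1 g j <= hits w g j s &
      ch <= 5 * k + 12 * k * potential (w None).1 g j B + sg]
  end.

Lemma eq_tracking w s g j B b b' sg ch : (forall i, b i = b' i) ->
  tracking w s g j B b sg ch -> tracking w s g j B b' sg ch.
Proof.
move=> bb; rewrite /tracking; case: B => [B [c cb H]|[bN ? ? ?]].
  by exists c => // i; rewrite -bb; exact: cb.
by split=> // i; rewrite -bb.
Qed.

Lemma tracking_other w s g i j j' B b sg ch : j != j' ->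
  tracking w s g j' B b sg ch -> tracking w (rcons s (i, j)) g j' B b sg ch.
Proof.
move=> jj; rewrite /tracking hits_other //.
have E i' : site_count (rcons s (i, j)) i' j' = site_count s i' j'.
  by rewrite site_count_rcons xpair_eqE (negbTE jj) andbF addn0.
case: B => // B [c cb [H1 H2 H3 H4 H5]]; exists c; first by move=> i'; rewrite E; exact: cb.
by split=> //; rewrite H2; apply: eq_bigr => i' _; rewrite E.
Qed.

(** Each site hides only the remainder of a division by [q], at most [q.-1] arrivals. *)
Lemma covered (s : stream k n) j (c : 'I_k -> nat) q : 0 < q -> (forall i, c i <= site_count s i j) ->
  freq s j <= \sum_i c i + q * (\sum_i (site_count s i j - c i) %/ q) + k * q.-1.
Proof.
move=> q0 cs; have -> : k * q.-1 = \sum_(i < k) q.-1 by rewrite sum_nat_const card_ord.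
rewrite big_distrr /= -!big_split /=; apply: leq_sum => i _.
have := cs i; have := divn_eq (site_count s i j - c i) q.
have := ltn_pmod (site_count s i j - c i) q0; rewrite [q * _]mulnC.
move: (_ %/ _ * _) (_ %% _) => x y; lia.
Qed.

Lemma covered_ge (s : stream k n) j (c : 'I_k -> nat) q : (forall i, c i <= site_count s i j) ->
  \sum_i c i + q * (\sum_i (site_count s i j - c i) %/ q) <= freq s j.
Proof.
move=> cs; rewrite big_distrr /= -!big_split /=; apply: leq_sum => i _.
have := cs i; have := leq_divM (site_count s i j - c i) q; rewrite [q * _]mulnC.
move: (_ %/ _ * _) => x; lia.
Qed.

(** With fewer than [alarm] signals the true count has not reached the next jump, so the value of
    [A] known to the coordinator is exact. *)
Lemma tracking_exact w s g j B b sg ch : tracking w s g j (Some B) b sg ch ->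
  B <= freq s j < next_jump m (A (w None).1 g j) B.
Proof.
case=> c cb [BE sgE sa _ _]; have cs i := (cb i).2.
have := covered (quota_gt0 m (A (w None).1 g j) k B) cs.
have := @covered_ge _ _ _ (quota m (A (w None).1 g j) k B) cs.
rewrite -BE -sgE; move: sa; rewrite alarm_lt // /gap.
have := next_jump_gt m (A (w None).1 g j) B.
move: (quota _ _ _ _ * sg) (k * _) => x y; lia.
Qed.

(** Either the gap is halved and [lg] drops, or a jump is passed: this adds [X.+1], more than the
    second summand of [potential] can lose. *)
Lemma potential_lt h g j B v : B <= m -> v <= m ->
  B + quota m (A h g j) k B * alarm m (A h g j) k B <= v ->
  (potential h g j B).+1 <= potential h g j v.
Proof.
move=> Bm vm Bv; rewrite /potential.
have lgB := lg_gap (A h g j) Bm m_lt; have lgv := lg_gap (A h g j) vm m_lt.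
case: (ltnP v (next_jump m (A h g j) B)) => vN.
  have Bv' : B <= v by lia.
  rewrite (@before_jump m _ (@A_mono h g j) B v) ?Bv' //.
  have := lg_halved (gap_gt0 m (A h g j) v) (gap_halved (@A_mono h g j) k_gt0 Bm Bv vN).
  lia.
have Av := after_jump (@A_mono h g j) (leq_trans vN vm) vN.
have : (A h g j B).+1 * X.+1 <= A h g j v * X.+1 by rewrite leq_mul2r Av orbT.
rewrite mulSn; have : 0 < lg (gap m (A h g j) B) by [].
move: (_ * X.+1) (_ * X.+1) => x y; lia.
Qed.

Lemma tracking_step w s g i j B b sg ch : size s < m ->
  tracking w s g j B b sg ch ->
  let s' := rcons s (i, j) in
  let cnt := site_count s' i j in
  let due := signal_due (w None).1 g j cnt ((w (Some i)).2 (g, j, inord cnt)) (b i) in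
  let poll := due && (needed (w None).1 g j B <= sg.+1) in
  tracking w s' g j (if poll then Some (freq s' j) else B)
    (fun i' => if poll then Some (site_count s' i' j, freq s' j) else b i')
    (if poll then 0 else sg + due) (ch + due + 3 * k * poll).
Proof.
move=> sm T s' cnt due poll.
have hitsE : hits w g j s' = hits w g j s +
    (watched (w None).1 g j cnt && hit (w None).1 g j ((w (Some i)).2 (g, j, inord cnt))).
  exact: hits_rcons.
have cntE i' : site_count s' i' j = site_count s i' j + (i' == i).
  by rewrite site_count_rcons xpair_eqE eqxx andbT eq_sym.
have frm : freq s' j <= m by apply: leq_trans (freq_size _ _) _; rewrite size_rcons.
have needed2 : hits_needed (w None).1 g j <= 2 by rewrite /hits_needed; case: ifP.
(* The state right after a poll has the same shape for a first and for a later poll; only the charge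
   remains to be bounded. *)
have after v : v <= m -> (forall i', site_count s' i' j <= v) ->
    hits_needed (w None).1 g j <= hits w g j s' ->
    forall ch', v = freq s' j -> ch' <= 5 * k + 12 * k * potential (w None).1 g j v ->
    tracking w s' g j (Some v) (fun i' => Some (site_count s' i' j, v)) 0 ch'.
  move=> vm _ Hh ch' vE Hc; exists (fun i' => site_count s' i' j) => //.
  split=> //; first by rewrite big1 // => i' _; rewrite subnn div0n.
    exact: alarm_gt0.
  by rewrite addn0.
case: B T @poll => [B|] T poll; rewrite /poll.
  have := T; case=> c cb [BE sgE sa Hh Hc].
  have /andP[Bf fN] := tracking_exact T.
  have q0 := quota_gt0 m (A (w None).1 g j) k B.
  have dueE : due = (quota m (A (w None).1 g j) k B %| cnt - c i).
    by rewrite /due; have [-> _] := cb i.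
  have cs i' : c i' <= site_count s' i' j by rewrite cntE; have [_ ] := cb i'; lia.
  (* A site signals exactly when its quotient by the quota goes up. *)
  have sgE' : sg + due = \sum_i' (site_count s' i' j - c i') %/ quota m (A (w None).1 g j) k B.
    rewrite sgE (bigD1 i) //= [RHS](bigD1 i) //= -addnA [X in _ + X]addnC addnA; congr (_ + _).
      have [_ ci] := cb i; rewrite dueE /cnt cntE eqxx addn1 subSn //.
      by rewrite divnS // addnC.
    by apply: eq_bigr => i' /negbTE ne; rewrite cntE ne addn0.
  have Hh' : hits_needed (w None).1 g j <= hits w g j s' by rewrite hitsE; lia.
  rewrite /needed; case: (boolP (due && _)) => [/andP[d al]|nal] /=.
    have sgal : sg.+1 = alarm m (A (w None).1 g j) k B by apply/eqP; rewrite eqn_leq al andbT.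
    apply: after => //; first by move=> i'; exact: site_count_freq.
    have Bf' : B <= freq s' j by rewrite freq_rcons; lia.
    have := @potential_lt (w None).1 g j B _ (leq_trans Bf' frm) frm.
    have := @covered_ge s' j c (quota m (A (w None).1 g j) k B) cs.
    rewrite -BE -sgE' d addn1 sgal => H /(_ H) Hp.
    have := alarm_le m (A (w None).1 g j) k_gt0 B; rewrite -sgal.
    move: Hc; set p0 := potential _ _ _ B in Hp *; set p1 := potential _ _ _ _ in Hp *.
    move=> Hc Hs; have : 12 * k * p0.+1 <= 12 * k * p1 by rewrite leq_mul2l Hp orbT.
    rewrite mulnS; move: (12 * k * p0) (12 * k * p1) Hc => x y; lia.
  exists c; first by move=> i'; have [-> _] := cb i'.
  split=> //.
    case: (boolP due) nal => d; rewrite ?addn0 // addn1 /= -ltnNge //.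
  by rewrite muln0 addn0 addnA leq_add2r.
have [bE sgE hl chE] := T.
have dueE : due = watched (w None).1 g j cnt && hit (w None).1 g j ((w (Some i)).2 (g, j, inord cnt)).
  by rewrite /due bE.
rewrite -dueE in hitsE.
rewrite /needed; case: (boolP (due && _)) => [/andP[d al]|nal] /=.
  apply: after => //; first by move=> i'; exact: site_count_freq.
    by rewrite hitsE ?d addn1 -sgE.
  rewrite ?d chE -sgE; move: hl; rewrite -sgE; lia.
split=> //; first by rewrite sgE hitsE.
  by rewrite hitsE; case: (boolP due) nal => d; rewrite ?addn0 // addn1 /= -ltnNge sgE.
by rewrite muln0 addn0 chE hitsE.
Qed.

(* Bounds the charge of a running tracker by a quantity that does not depend on the
   execution, only on the coins and the input. *)
Definition due_cost (w : coins tracker) s g j : nat :=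
  hits w g j s + (hits_needed (w None).1 g j <= hits w g j s) *
    (25 * k * X.+1 * (A (w None).1 g j (freq s j)).+1).

(** The constant [25] of [due_cost] is [5 + 12 + 8]: first poll, potential and signals since the
    last poll. The value of [A] at the last poll equals its value at the current count. *)
Lemma tracking_cost w s g j B b sg ch : size s <= m ->
  tracking w s g j B b sg ch -> ch <= due_cost w s g j.
Proof.
move=> sm; case: B => [B|] T; last by have [_ _ _ ->] := T; rewrite /due_cost leq_addr.
have /andP[Bf fN] := tracking_exact T.
have AE : A (w None).1 g j (freq s j) = A (w None).1 g j B.
  by apply: (@before_jump m _ (@A_mono _ _ _)); rewrite Bf.
case: T => c cb [BE sgE sa Hh Hc]; rewrite /due_cost Hh mul1n AE.
apply: leq_trans Hc _; apply: leq_trans (leq_addl _ _).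
have := alarm_le m (A (w None).1 g j) k_gt0 B.
have : 12 * k * potential (w None).1 g j B <= 12 * k * (X.+1 * (A (w None).1 g j B).+1).
  rewrite leq_mul2l /potential [X.+1 * _.+1]mulnS [X.+1 + _]addnC [X.+1 * _]mulnC.
  by rewrite leq_add2l leq_subr orbT.
have : k <= k * (X.+1 * (A (w None).1 g j B).+1) by rewrite leq_pmulr.
rewrite -!mulnA; move: (X.+1 * _) => y; move: (k * y) => z; lia.
Qed.

(** Monotonicity keeps a halt justified on every longer prefix. *)
Lemma leq_due_cost w g i j j' s : size s < m ->
  due_cost w s g j' <= due_cost w (rcons s (i, j)) g j'.
Proof.
move=> sm; rewrite /due_cost; have [<-|jj] := eqVneq j j'; last first.
  by rewrite hits_other // freq_rcons /= (negbTE jj) addn0.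
have hl : hits w g j s <= hits w g j (rcons s (i, j)) by rewrite hits_rcons // leq_addr.
apply: leq_add => //; apply: leq_mul.
  by case: (boolP (_ <= hits w g j s)) => // H; rewrite (leq_trans H hl).
by rewrite leq_mul2l ltnS A_mono ?orbT // freq_rcons leq_addr.
Qed.

(** A halted scale is justified by [due_cost], a bound free of the execution. The last exchange of a
    scale may overshoot the budget by one signal, one poll and one halt, hence [1 + 6 * k]. *)
Record invariant (w : coins tracker) (s : stream k n) (c : config tracker) : Prop := {
  inv_coherent : coherent w s c;
  inv_tracking : forall g j, g \notin halted (coordinator c) ->
    tracking w s g j (base (coordinator c) (g, j)) (fun i => site_base (sites c i) (g, j))
      (signals (coordinator c) (g, j)) (charge (coordinator c) (g, j));
  inv_running : forall g, g \notin halted (coordinator c) ->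
    \sum_j charge (coordinator c) (g, j) <= Bud;
  inv_halted : forall g, g \in halted (coordinator c) -> Bud < \sum_j due_cost w s g j;
  inv_charge : forall g, \sum_j charge (coordinator c) (g, j) <= Bud + 1 + 6 * k;
  inv_bits : bits c <= l * (k + \sum_g \sum_j charge (coordinator c) (g, j))
}.

Lemma site_count_nil i j : site_count ([::] : stream k n) i j = 0.
Proof. by []. Qed.

Lemma hits_nil w g j : hits w g j [::] = 0.
Proof.
apply: big1 => e; rewrite !inE site_count_nil leqn0 /watched.
by case/andP=> _ /andP[/andP[_ H] /eqP e0]; rewrite e0 in H.
Qed.

Lemma invariant_start w : invariant w [::] (start w).
Proof.
have startE : start w = @Config _ _ _ tracker
   [ffun i => Site (w None).1 (w (Some i)).2 [ffun => 0] [ffun => None] set0]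
   (Coord (w None).1 [ffun => 0] [ffun => None] [ffun => 0] set0 None) silence (k * l).
  rewrite /start /= /send_down.
  have -> : \sum_(i < k) size ([ffun _ : 'I_k => encode l (inl (w None).1 : down_msg)] i) = k * l.
    by under eq_bigr do rewrite ffunE size_encode; rewrite sum_nat_const card_ord.
  set c := Config _ _ _ _.
  have -> : c = @Config _ _ _ tracker
     [ffun i => Site (w None).1 (w (Some i)).2 [ffun => 0] [ffun => None] set0]
     (Coord (w None).1 [ffun => 0] [ffun => None] [ffun => 0] set0 None) silence (k * l).
    by congr Config; apply/ffunP => i; rewrite !ffunE nilp_encode /= /obey encodeK.
  by rewrite /settle /= !round_silent.
rewrite startE; split=> /=.
- by split=> //= i; rewrite ffunE // => j; rewrite ffunE.
- move=> g j _; rewrite /tracking ffunE hits_nil !ffunE; split=> // [i|]; first by rewrite !ffunE.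
  by rewrite /hits_needed; case: ifP.
- by move=> g _; rewrite big1 // => j _; rewrite ffunE.
- by move=> g; rewrite inE.
- by move=> g; rewrite big1 // => j _; rewrite ffunE.
- by rewrite mulnC leq_mul2l leq_addr orbT.
Qed.

Lemma sum_eqb (j : 'I_n) (x : nat) : \sum_(j' < n) (j' == j) * x = x.
Proof. by rewrite (bigD1 j) //= eqxx mul1n big1 ?addn0 // => i /negbTE ->. Qed.

Lemma sum_mem_ge (I : finType) (D : {set I}) : (D != set0 : nat) <= \sum_i (i \in D).
Proof.
case: (set_0Vmem D) => [->|[x xD]]; first by rewrite eqxx.
rewrite (bigD1 x) //= xD; lia.
Qed.

Lemma invariant_arrive w s c a : size s < m -> invariant w s c ->
  invariant w (rcons s a) (settle (arrive c a)).
Proof.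
case: a => i j sm [coh trk run_ hlt chg bts].
have [b -> ] := settle_arrive i j coh sm.
set s' := rcons s (i, j); set x := coordinator c.
set due := due_set _ _ _ _ _; set Q := polled _ _ _; set H := overspent _ _ _ => bE.
have xE : coord_hash x = (w None).1 by case: coh.
have dueP g : g \in due = (g \notin halted x) && signal_due (w None).1 g j (site_count s' i j)
      ((w (Some i)).2 (g, j, inord (site_count s' i j))) (site_base (sites c i) (g, j)).
  by rewrite inE.
have QP g : g \in Q = (g \in due) && (needed (w None).1 g j (base x (g, j)) <= (signals x (g, j)).+1).
  by rewrite inE xE.
have HP g : g \in H = (g \in due) && (Bud < \sum_i charge_after x j due (g, i)) by rewrite inE.
have cafterE g : \sum_i charge_after x j due (g, i) =
    \sum_i charge x (g, i) + ((g \in due) + 3 * k * (g \in Q)).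
  by under eq_bigr do rewrite ffunE; rewrite big_split /= sum_eqb.
(* Tracking is shown before the surcharge for halting is added; that surcharge only concerns scales
   that cease to be tracked. *)
have trk' g j' : g \notin halted x -> tracking w s' g j'
    (if (g \in Q) && (j' == j) then Some (freq s' j) else base x (g, j'))
    (fun i' => if (g \in Q) && (j' == j) then Some (site_count s' i' j, freq s' j)
               else site_base (sites c i') (g, j'))
    (if (g \in Q) && (j' == j) then 0 else signals_after x j due (g, j'))
    (charge_after x j due (g, j')).
  move=> gh; have [->|jj] := eqVneq j' j; last first.
    rewrite andbF !ffunE (negbTE jj) /= andbF !addn0.
    by apply: tracking_other; [rewrite eq_sym|exact: trk].
  rewrite !ffunE eqxx !andbT mul1n addnA.
  have := tracking_step i sm (trk g j gh); rewrite -/x -/s' /= -/Q.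
  by rewrite -[signal_due _ _ _ _ _ _]/(true && _) -gh -dueP -QP.
split=> /=.
- split=> //= i'; rewrite ffunE //= => j'; by rewrite ffunE.
- move=> g j'; rewrite inE negb_or => /andP[gh gH].
  have := trk' g j' gh; rewrite !ffunE /= (negbTE gH) !muln0 addn0.
  by apply: eq_tracking => i'; rewrite !ffunE.
- move=> g; rewrite inE negb_or => /andP[gh gH].
  under eq_bigr do rewrite ffunE (negbTE gH) !muln0 addn0.
  move: gH; rewrite HP; case: (boolP (g \in due)) => [_|gd _]; first by rewrite -leqNgt.
  by rewrite cafterE QP (negbTE gd) muln0 !addn0 run_.
(* A scale halted earlier stays justified by monotonicity; one halted now has a charge above the
   budget, and the charge is at most [due_cost]. *)
- move=> g; rewrite inE => /orP[gh|].
    by apply: leq_trans (hlt g gh) _; apply: leq_sum => j' _; exact: leq_due_cost.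
  rewrite HP => /andP[gd /leq_trans]; apply.
  apply: leq_sum => j' _; have gh : g \notin halted x by move: gd; rewrite dueP => /andP[].
  apply: tracking_cost (trk' g j' gh); by rewrite size_rcons.
- move=> g; under eq_bigr do rewrite ffunE /=; rewrite big_split /= sum_eqb cafterE.
  case: (boolP (g \in due)) => gd; last first.
    by rewrite HP QP (negbTE gd) !muln0 !addn0 chg.
  have gh : g \notin halted x by move: gd; rewrite dueP => /andP[].
  have := run_ g gh; rewrite -/x; case: (_ \in Q); case: (_ \in H) => /=; lia.
- apply: leq_trans bE _; apply: leq_trans (leq_add (leq_add bts (leqnn _)) (leqnn _)) _.
  have -> : \sum_g \sum_j' [ffun e => charge_after x j due e +
        (e.2 == j) * (3 * k * (e.1 \in H))] (g, j') =
      \sum_g \sum_j' charge x (g, j') +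
        (\sum_g (g \in due) + 3 * k * (\sum_g (g \in Q) + \sum_g (g \in H))).
    rewrite -big_split /= big_distrr /= -!big_split /=; apply: eq_bigr => g _.
    under eq_bigr do rewrite ffunE /=; rewrite big_split /= sum_eqb cafterE.
    by case: (_ \in Q); case: (_ \in H) => /=; lia.
  have d1 := sum_mem_ge due.
  have d2 : (Q :|: H != set0 : nat) <= \sum_g (g \in Q) + \sum_g (g \in H).
    apply: leq_trans (sum_mem_ge _) _; rewrite -big_split /=; apply: leq_sum => g _.
    by rewrite inE; case: (_ \in Q); case: (_ \in H).
  have d3 := leq_mul (leqnn (3 * k * l)) d2; have d4 := leq_mul (leqnn l) d1.
  apply: leq_trans (leq_add (leq_add (leqnn _) d4) d3) _; rewrite -/x.
  move: (\sum_g \sum_j _) (\sum_g (g \in due)) (\sum_g (g \in Q)) (\sum_g (g \in H)).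
  by move=> P1 P2 P3 P4; rewrite !mulnDr !mulnA; lia.
Qed.

Lemma invariant_run w s : size s <= m -> invariant w s (run w s).
Proof.
elim/last_ind: s => [|s a IH]; first by move=> _; exact: invariant_start.
rewrite size_rcons => sm; rewrite /run -cats1 foldl_cat /= cats1.
exact: invariant_arrive sm (IH (ltnW sm)).
Qed.

Lemma quiet_run w s : size s <= m -> quiet (run w s : config tracker).
Proof.
move=> /(invariant_run w) [[upE _ _ _ _ _ _] _ _ _ _ _].
by apply/forallP => i; rewrite upE ffunE.
Qed.

Lemma cost_run (w : coins tracker) s :
  size s <= m -> cost w s <= l * (k + G * (Bud + 1 + 6 * k)).
Proof.
move=> /(invariant_run w) [_ _ _ _ chg bts].
apply: leq_trans bts _; rewrite leq_mul2l leq_add2l; apply/orP; right.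
apply: (@leq_trans (\sum_(g < G) (Bud + 1 + 6 * k))); first exact: leq_sum.
by rewrite sum_nat_const card_ord.
Qed.

(** Scale [g] cannot have been halted, so the answer comes from some [g' <= g]. There polled items
    contribute their exact value, and an item never polled lacks hits, so that by the last
    hypothesis its value is zero. *)
Lemma output_run (w : coins tracker) s g : size s <= m ->
  \sum_j due_cost w s g j <= Bud ->
  (forall (g' : 'I_G) j, g' <= g -> 0 < A (w None).1 g' j (freq s j) ->
     hits_needed (w None).1 g' j <= hits w g' j s) ->
  exists2 g' : 'I_G, g' <= g &
    output w s = (tau g' * (\sum_j A (w None).1 g' j (freq s j))%:R)%R.
Proof.
move=> sm; have [[_ _ hE _ _ _ _] trk _ hlt _ _] := invariant_run w sm => gB ex.
have gh : g \notin halted (coordinator (run w s)).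
  by apply/negP => /hlt; rewrite ltnNge gB.
rewrite /output /= /answer; case: pickP => [g' /andP[g'h /forallP lt]|no].
  have g'g : g' <= g.
    by rewrite leqNgt; apply/negP => /(implyP (lt g)); rewrite (negbTE gh).
  exists g' => //; congr (_ * _%:R)%R; apply: eq_bigr => j _; rewrite /tally hE.
  have := trk g' j g'h; case: (base (coordinator (run w s)) (g', j)) => [B|] T.
    by apply/esym/(@before_jump m _ (@A_mono _ _ _))/(tracking_exact T).
  have [_ _ hn _] := T; case: (posnP (A (w None).1 g' j (freq s j))) => // /(ex _ _ g'g).
  by rewrite leqNgt hn.
case: (@arg_minnP _ g (fun g => g \notin halted (coordinator (run w s))) val gh) => g' g'h min.
have := no g'; rewrite g'h /= => /negbT /forallPn[i]; rewrite negb_imply => /andP[ig ih].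
by have := min i ih; rewrite leqNgt ig.
Qed.

End Protocol.

(** * Averages over independent seeds *)

Local Open Scope ring_scope.

Section Mean.
Variable R : realType.

Definition mean (T : finType) (f : T -> R) : R := (\sum_t f t) / #|T|%:R.

Lemma eq_mean (T : finType) (f g : T -> R) : f =1 g -> mean f = mean g.
Proof. by move=> fg; congr (_ / _); apply: eq_bigr. Qed.

Lemma mean_le (T : finType) (f g : T -> R) : (forall t, f t <= g t) -> mean f <= mean g.
Proof. by move=> fg; rewrite ler_wpM2r ?invr_ge0 //; apply: ler_sum. Qed.

Lemma mean_ge0 (T : finType) (f : T -> R) : (forall t, 0 <= f t) -> 0 <= mean f.
Proof. by move=> f0; rewrite divr_ge0 // sumr_ge0. Qed.

Lemma meanD (T : finType) (f g : T -> R) : mean (fun t => f t + g t) = mean f + mean g.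
Proof. by rewrite /mean big_split /= mulrDl. Qed.

Lemma meanZ (T : finType) a (f : T -> R) : mean (fun t => a * f t) = a * mean f.
Proof. by rewrite /mean -mulr_sumr mulrA. Qed.

Lemma mean_sum (T I : finType) (P : pred I) (f : I -> T -> R) :
  mean (fun t => \sum_(i | P i) f i t) = \sum_(i | P i) mean (f i).
Proof. by rewrite /mean exchange_big /= mulr_suml. Qed.

Lemma mean_cst (T : finType) (x : T) a : mean (fun _ : T => a) = a.
Proof.
by rewrite /mean sumr_const -[a *+ _]mulr_natr mulfK // pnatr_eq0 -lt0n; apply/card_gt0P; exists x.
Qed.

(** The mean over an empty type is zero, since division by zero yields zero; hence the sign
    condition on [a]. *)
Lemma mean_le_cst (T : finType) (f : T -> R) a :
  0 <= a -> (forall t, f t <= a) -> mean f <= a.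
Proof.
move=> a0 fa; have [x _|T0] := pickP (@predT T).
  by rewrite -[leRHS](mean_cst x) mean_le.
by rewrite /mean big_pred0 ?mul0r.
Qed.

Lemma mean_ffun (I T : finType) (F : I -> T -> R) :
  mean (fun w : {ffun I -> T} => \prod_i F i (w i)) = \prod_i mean (F i).
Proof.
rewrite /mean -bigA_distr_bigA /= card_ffun big_split /= prodr_const natrX exprVn.
by rewrite cardT.
Qed.

Lemma mean_pair (S T : finType) (f : S -> R) (g : T -> R) :
  mean (fun u : S * T => f u.1 * g u.2) = mean f * mean g.
Proof.
rewrite /mean card_prod natrM -(pair_big predT predT (fun x y => f x * g y)) /=.
rewrite invfM mulrACA; congr (_ * _); rewrite mulr_suml; apply: eq_bigr => x _.
by rewrite mulr_sumr.
Qed.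

Lemma prod_option (I : finType) (F : option I -> R) :
  \prod_o F o = F None * \prod_i F (Some i).
Proof.
rewrite (bigD1 None) //=; congr (_ * _).
rewrite (reindex_omap Some id) /=; first by apply: eq_bigl => i; rewrite eqxx.
by case.
Qed.

Section Coins.
Variables (I H K U : finType).
Let coins := {ffun option I -> H * {ffun K -> U}}.

(** Independence of the seeds: after splitting by the value [h] of the coordinator's hash, each
    summand is a product of functions of a single seed. *)
Lemma mean_coins (u0 : U) (phi : H -> R) (f : H -> I * K -> U -> R) :
  mean (fun w : coins => phi (w None).1 *
    \prod_e f (w None).1 e ((w (Some e.1)).2 e.2)) =
  mean (fun h => phi h * \prod_e mean (f h e)).
Proof.
pose F h (o : option I) (x : H * {ffun K -> U}) : R :=
  if o is Some i then \prod_q f h (i, q) (x.2 q) else (x.1 == h)%:R.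
transitivity (mean (fun w : coins => \sum_h phi h * \prod_o F h o (w o))).
  apply: eq_mean => w; rewrite (bigD1 (w None).1) //= prod_option /= eqxx mul1r.
  rewrite [X in _ + X]big1 ?addr0; last first.
    by move=> h /negbTE hw; rewrite prod_option /= eq_sym hw mul0r mulr0.
  congr (_ * _); rewrite pair_bigA.
  by apply: eq_bigr => -[].
rewrite mean_sum [RHS]/mean mulr_suml; apply: eq_bigr => h _.
rewrite meanZ mean_ffun prod_option /=.
have -> : mean (fun x : H * {ffun K -> U} => (x.1 == h)%:R) = #|H|%:R^-1.
  under eq_mean => x do rewrite -[_%:R]mulr1.
  rewrite (mean_pair (fun x => (x == h)%:R) (fun _ => 1)) (mean_cst [ffun => u0]) mulr1.
  rewrite /mean (bigD1 h) //= eqxx big1 ?addr0 ?mul1r // => i /negbTE -> //.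
rewrite mulrCA mulrC; congr (_ * _ / _).
have -> : \prod_e mean (f h e) = \prod_i \prod_q mean (f h (i, q)).
  by rewrite pair_bigA; apply: eq_bigr => -[].
apply: eq_bigr => i _.
transitivity (mean (fun x : H * {ffun K -> U} => 1 * \prod_q f h (i, q) (x.2 q))).
  by apply: eq_mean => x; rewrite mul1r.
rewrite (mean_pair (fun _ => 1) (fun x : {ffun K -> U} => \prod_q f h (i, q) (x q))).
by rewrite (mean_cst h) mul1r; exact: (mean_ffun (fun q => f h (i, q))).
Qed.

Lemma mean_coins_in (u0 : U) (phi : H -> R) (W : H -> {set I * K})
    (f : H -> I * K -> U -> R) :
  mean (fun w : coins => phi (w None).1 *
    \prod_(e in W (w None).1) f (w None).1 e ((w (Some e.1)).2 e.2)) =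
  mean (fun h => phi h * \prod_(e in W h) mean (f h e)).
Proof.
under eq_mean => w do rewrite big_mkcond.
rewrite (@mean_coins u0 phi (fun h e u => if e \in W h then f h e u else 1)).
apply: eq_mean => h; rewrite [in RHS]big_mkcond; congr (_ * _); apply: eq_bigr => e _.
by case: ifP => // _; exact: mean_cst.
Qed.

Lemma mean_hash (u0 : U) (phi : H -> R) : mean (fun w : coins => phi (w None).1) = mean phi.
Proof.
have := mean_coins_in u0 phi (fun _ => set0) (fun _ _ _ => 1).
under eq_mean => w do rewrite big_set0 mulr1.
by under [X in _ = X -> _]eq_mean => w do rewrite big_set0 mulr1.
Qed.

End Coins.
End Mean.

(** * Random rounding by a pairwise independent hash *)

Section AffineHash.
Variables (R : realType) (F : finFieldType).

(** For distinct points, the pair of values of an affine map determines its coefficients, so the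
    pair is uniform on [F * F]. *)
Lemma mean_affine2 (x y : F) (phi psi : F -> R) : x != y ->
  mean (fun h : F * F => phi (h.1 * x + h.2) * psi (h.1 * y + h.2)) = mean phi * mean psi.
Proof.
move=> xy; rewrite -mean_pair /mean; congr (_ / _).
have inj : injective (fun h : F * F => (h.1 * x + h.2, h.1 * y + h.2)).
  move=> [a b] [c d] /= [E1 E2].
  have /eqP : (a - c) * (x - y) = 0.
    rewrite mulrBr !mulrBl.
    have -> : a * x = c * x + d - b by rewrite -E1 addrK.
    have -> : a * y = c * y + d - b by rewrite -E2 addrK.
    by ring.
  rewrite mulf_eq0 !subr_eq0 (negbTE xy) orbF => /eqP ac.
  by move: E1; rewrite ac => /addrI ->.
by rewrite [RHS](reindex_inj inj).
Qed.

Lemma mean_affine (x : F) (phi : F -> R) :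
  mean (fun h : F * F => phi (h.1 * x + h.2)) = mean phi.
Proof.
have x1 : x != x + 1.
  by rewrite -subr_eq0 opprD addrA subrr add0r oppr_eq0 oner_eq0.
have := mean_affine2 phi (fun _ => 1) x1; rewrite (mean_cst (0 : F)) mulr1 => <-.
by apply: eq_mean => h; rewrite mulr1.
Qed.

Lemma mean_rank (phi : nat -> R) :
  mean (fun u : F => phi (enum_rank u)) = mean (fun x : 'I_#|F| => phi x).
Proof.
rewrite /mean card_ord; congr (_ / _).
by rewrite [RHS](reindex enum_rank) //=; exact/onW_bij/enum_rank_bij.
Qed.

End AffineHash.

Section RandomRounding.
Variables (R : realType) (M : nat).
Hypothesis M_gt0 : (0 < M)%N.

(** For uniform [x < M] this rounds [Z / M] up with probability equal to its fractional part. *)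
Definition round_up (Z x : nat) : nat := ((Z + x) %/ M)%N.

Lemma round_upE Z (x : 'I_M) :
  round_up Z x = (Z %/ M + (M - Z %% M <= x))%N.
Proof.
rewrite /round_up {1}(divn_eq Z M) -addnA divnMDl //; congr addn.
have := ltn_pmod Z M_gt0; have := ltn_ord x; move: (Z %% M)%N (x : nat) => b y yM bM.
case: leqP => h; last by rewrite divn_small //; lia.
have -> : (b + y = 1 * M + (b + y - M))%N by lia.
by rewrite divnMDl // divn_small //; lia.
Qed.

Lemma mean_ge (b : nat) : (b <= M)%N ->
  mean (fun x : 'I_M => (M - b <= x)%N%:R : R) = b%:R / M%:R.
Proof.
move=> bM; rewrite /mean card_ord -natr_sum; congr (_%:R / _).
rewrite -(big_mkord predT (fun x => (M - b <= x : nat)%N)).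
rewrite (big_cat_nat (n := M - b)) ?leq_subr //= big1_seq ?add0n; last first.
  by move=> i /=; rewrite mem_index_iota => /andP[_ H]; rewrite leqNgt H.
rewrite (eq_big_nat _ _ (F2 := fun => 1%N)); last by move=> i /andP[-> _].
by rewrite sum_nat_const_nat muln1 subKn.
Qed.

Lemma M_neq0 : M%:R != 0 :> R.
Proof. by rewrite pnatr_eq0 -lt0n. Qed.

Lemma natr_divn_eq Z : Z%:R / M%:R = (Z %/ M)%:R + (Z %% M)%:R / M%:R :> R.
Proof. by rewrite {1}(divn_eq Z M) natrD natrM mulrDl mulfK ?M_neq0. Qed.

Lemma mean_round_up Z : mean (fun x : 'I_M => (round_up Z x)%:R : R) = Z%:R / M%:R.
Proof.
under eq_mean => x do rewrite round_upE natrD.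
rewrite meanD (mean_cst (Ordinal M_gt0)) mean_ge; last first.
  by rewrite ltnW // ltn_pmod.
by rewrite [RHS]natr_divn_eq.
Qed.

Lemma round_up_var Z :
  mean (fun x : 'I_M => ((round_up Z x)%:R - Z%:R / M%:R) ^+ 2 : R) <= Z%:R / M%:R.
Proof.
pose f : R := (Z %% M)%:R / M%:R.
have -> : mean (fun x : 'I_M => ((round_up Z x)%:R - Z%:R / M%:R) ^+ 2 : R) = f - f ^+ 2.
  (* The square is linear in the indicator of rounding up. The variance is thus that of a Bernoulli
     variable of parameter [f]. *)
  transitivity (mean (fun x : 'I_M => (1 - 2 * f) * (M - Z %% M <= x)%N%:R + f ^+ 2)).
    apply: eq_mean => x; rewrite round_upE natrD [Z%:R / M%:R]natr_divn_eq -/f.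
    by case: (_ <= _)%N => /=; ring.
  rewrite meanD meanZ (mean_cst (Ordinal M_gt0)) mean_ge -/f; last by rewrite ltnW // ltn_pmod.
  by ring.
rewrite [leRHS]natr_divn_eq -/f; have := sqr_ge0 f; have : 0 <= (Z %/ M)%:R :> R by [].
lra.
Qed.

End RandomRounding.

Section HashedRounding.
Variables (R : realType) (F : finFieldType) (n : nat) (x : 'I_n -> F).
Hypothesis x_inj : injective x.

Definition hash_rank (h : F * F) (j : 'I_n) : nat := enum_rank (h.1 * x j + h.2).

Lemma card_F_gt0 : (0 < #|F|)%N.
Proof. by apply/card_gt0P; exists 0. Qed.

Lemma mean_hashed (phi : nat -> R) j :
  mean (fun h : F * F => phi (hash_rank h j)) = mean (fun y : 'I_#|F| => phi y).
Proof. by rewrite -mean_rank -(mean_affine (x j)). Qed.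

(** The deviations are centred and pairwise independent, so the cross terms vanish. *)
Lemma hashed_sum_var (Z : 'I_n -> nat) :
  mean (fun h : F * F => (\sum_j
    ((round_up #|F| (Z j) (hash_rank h j))%:R - (Z j)%:R / #|F|%:R)) ^+ 2 : R)
  <= \sum_j (Z j)%:R / #|F|%:R.
Proof.
pose D j (y : nat) : R := (round_up #|F| (Z j) y)%:R - (Z j)%:R / #|F|%:R.
have D0 j : mean (fun u : F => D j (enum_rank u)) = 0.
  rewrite (mean_rank F (D j)) meanD mean_round_up ?card_F_gt0 //.
  by rewrite (mean_cst (Ordinal card_F_gt0)) subrr.
have -> : mean (fun h : F * F => (\sum_j D j (hash_rank h j)) ^+ 2) =
    \sum_j mean (fun h => D j (hash_rank h j) ^+ 2).
  under eq_mean => h do rewrite expr2 mulr_suml.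
  rewrite mean_sum; apply: eq_bigr => i _.
  under eq_mean => h do rewrite mulr_sumr.
  rewrite mean_sum (bigD1 i) //= big1 ?addr0.
    by under eq_mean => h do rewrite -expr2.
  move=> j ji; rewrite -[RHS](mul0r (mean (fun u : F => D j (enum_rank u)))) -(D0 i).
  rewrite -(@mean_affine2 _ _ (x i) (x j)) //.
  by rewrite inj_eq // eq_sym.
apply: ler_sum => j _; rewrite (mean_hashed (fun y => D j y ^+ 2)).
exact: round_up_var card_F_gt0 _.
Qed.

End HashedRounding.

(** Reversing the index gives the harmonic sum up to [2 ^ L]: after the first term, each of [L]
    dyadic blocks contributes at most one. *)
Lemma harmonic_le (R : realType) L :
  mean (fun y : 'I_(2 ^ L) => (2 ^ L)%:R / (2 ^ L - y)%:R : R) <= L.+1%:R.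
Proof.
have -> : mean (fun y : 'I_(2 ^ L) => (2 ^ L)%:R / (2 ^ L - y)%:R : R) =
    \sum_(0 <= i < 2 ^ L) i.+1%:R^-1.
  rewrite /mean card_ord -mulr_sumr mulrC mulKf; last by rewrite pnatr_eq0 expn_eq0.
  rewrite (reindex_inj rev_ord_inj) /= big_mkord; apply: eq_bigr => i _.
  by congr (_%:R^-1); have := ltn_ord i; lia.
elim: L => [|L IH]; first by rewrite expn0 big_nat1 invr1.
rewrite (big_cat_nat (n := 2 ^ L)) ?leq_exp2l //=.
rewrite -[L.+2%:R]natr1 lerD //.
apply: le_trans (_ : \sum_(2 ^ L <= i < 2 ^ L.+1) (2 ^ L)%:R^-1 <= _).
  apply: ler_sum_nat => i /andP[Hi _]; rewrite lef_pV2 ?posrE ?ltr0n ?expn_gt0 //.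
  by rewrite ler_nat leqW.
rewrite sumr_const_nat expnS mul2n -addnn addnK -[_ *+ _]mulr_natr mulVf //.
by rewrite pnatr_eq0 expn_eq0.
Qed.

(** * Missed jumps and expected cost *)

Lemma card_ord_itv N a c : (c < N)%N -> #|[set v : 'I_N | (a < v <= c)%N]| = (c - a)%N.
Proof.
move=> cN; have lt (i : 'I_(c - a)) : (a.+1 + i < N)%N by have := ltn_ord i; lia.
have inj : injective (fun i => Ordinal (lt i)) by move=> i i' [] /addnI /val_inj.
rewrite -[RHS]card_ord -cardsT -(card_imset _ inj); congr #|pred_of_set _|.
apply/setP => v; rewrite inE; apply/idP/imsetP => [/andP[av vc]|[i _ ->]].
  have vi : (v - a.+1 < c - a)%N by lia.
  by exists (Ordinal vi) => //; apply/val_inj; rewrite /= subnKC.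
by have := ltn_ord i; rewrite /=; lia.
Qed.

Section ExpectedCost.
Variables (R : realType) (k n m G l : nat) (hash : finType).
Variables (A : hash -> 'I_G -> 'I_n -> nat -> nat) (lam Bud : nat) (tau : 'I_G -> R).
Hypotheses (k_gt0 : (0 < k)%N) (lam_gt0 : (0 < lam)%N).
Hypotheses (A_mono : forall h g j, {homo A h g j : x y / (x <= y)%N}).
Hypothesis (A0 : forall h g j, A h g j 0 = 0%N).

Let P : protocol R k n := tracker k m l A lam Bud tau.
Variables (s : stream k n) (g : 'I_G) (j : 'I_n).
Hypothesis size_s : (size s <= m)%N.

Let T h := first_jump m A h g j.
Let v := freq s j.
Let W h := window m A lam h g j s.
Let N h := #|W h|.

Lemma T_gt0 h : (0 < T h)%N.
Proof. exact: next_jump_gt. Qed.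

Lemma T_le h : (0 < A h g j v)%N -> (T h <= v)%N.
Proof.
move=> A1; rewrite leqNgt; apply/negP => vT.
by move: A1; rewrite (@before_jump m _ (A_mono h g j) 0 v) ?A0 // vT.
Qed.

Lemma v_le_m : (v <= m)%N.
Proof. exact: leq_trans (freq_size _ _) size_s. Qed.

Lemma card_window h : (T h <= m)%N ->
  N h = (\sum_(i < k) (site_count s i j - offset k m A lam h g j))%N.
Proof.
move=> Tm; pose D : {set 'I_k * 'I_m.+1} :=
  [set q : 'I_k * 'I_m.+1 | (offset k m A lam h g j < q.2 <= site_count s q.1 j)%N].
have -> : N h = #|D|.
  rewrite -(@card_imset _ _ (fun q : 'I_k * 'I_m.+1 => (q.1, (g, j, q.2)))); last first.
    by move=> [a b] [c d] [-> ->].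
  congr #|pred_of_set _|; apply/setP => -[i [gj u]]; rewrite !inE /watched -/(T h) Tm /=.
  apply/andP/imsetP => [[/eqP -> H]|[[i' u'] + [-> -> ->]]]; first by exists (i, u); rewrite ?inE.
  by rewrite inE eqxx.
rewrite -sum1_card (eq_bigl (fun q : 'I_k * 'I_m.+1 => predT q.1 &&
   (offset k m A lam h g j < q.2 <= site_count s q.1 j)%N)); last by move=> q; rewrite inE.
rewrite -(pair_big_dep predT (fun i (u : 'I_m.+1) => (offset k m A lam h g j < u <= site_count s i j)%N)
  (fun _ _ => 1%N)) /=.
apply: eq_bigr => i _; rewrite -(@card_ord_itv m.+1) ?ltnS; last first.
  exact: leq_trans (site_count_freq _ _ _) v_le_m.
by rewrite -sum1_card; apply: eq_bigl => u; rewrite inE.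
Qed.

Lemma window_empty h : (m < T h)%N -> W h = set0.
Proof.
move=> mT; apply/setP => e; rewrite !inE /watched -/(T h) leqNgt mT /=.
by rewrite andbF.
Qed.

Lemma card_window_le h : (N h <= v)%N.
Proof.
case: (leqP (T h) m) => [Tm|/window_empty W0]; last by rewrite /N W0 cards0.
by rewrite card_window //; apply: leq_sum => i _; exact: leq_subr.
Qed.

(** The [k] sites together hide at most [k * (T h %/ (2 * k))] arrivals, at most half of [T h]. *)
Lemma card_window_ge h : (lam < T h <= v)%N -> (T h <= 2 * N h)%N.
Proof.
case/andP=> lT Tv; rewrite card_window ?(leq_trans Tv v_le_m) //.
have -> : offset k m A lam h g j = (T h %/ (2 * k))%N by rewrite /offset leqNgt lT.
set o := (_ %/ _)%N.
have : (v <= \sum_(i < k) (site_count s i j - o) + k * o)%N.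
  have -> : (k * o = \sum_(i < k) o)%N by rewrite sum_nat_const card_ord.
  by rewrite -big_split /=; apply: leq_sum => i _; lia.
have := leq_divM (T h) (2 * k); rewrite -/o.
rewrite mulnCA [(o * k)%N]mulnC; move: (k * o)%N => x; rewrite -/v -/(T h); lia.
Qed.

Lemma card_window_gt0 h : (lam < T h)%N -> (0 < N h)%N -> (T h <= 2 * k * v)%N.
Proof.
move=> lT N0; case: (leqP (T h) m) => [Tm|/window_empty W0]; last by rewrite /N W0 cards0 in N0.
move: N0; rewrite card_window // lt0n sum_nat_eq0 => /forallPn[i]; rewrite negb_imply /= -lt0n subn_gt0.
rewrite /offset -/(T h) [(T h <= lam)%N]leqNgt lT /= => H.
have H2 : (T h %/ (2 * k) < v)%N := leq_trans H (site_count_freq _ _ _).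
by rewrite ltnW // mulnC -ltn_divLR // muln_gt0.
Qed.

Definition hit_rate h : R := mean (fun u : coin m => (hit A lam h g j u)%:R).

Lemma hit_rateE h : (lam < T h <= m)%N ->
  lam%:R / (T h)%:R <= hit_rate h <= 2 * lam%:R / (T h)%:R.
Proof.
(* [c] is the number of winning coins, [lam * m.+1 / T h] rounded up. Rounding at most doubles it
   because [T h <= lam * m.+1]. *)
case/andP=> lT Tm; pose c := ((lam * m.+1).-1 %/ T h).+1.
have T0 := T_gt0 h.
have c1 : (c <= m.+1)%N.
  rewrite ltnS -ltnS ltn_divLR //; apply: (@leq_trans (lam * m.+1)).
    by rewrite prednK // muln_gt0 lam_gt0.
  by rewrite mulnC leq_mul2l ltnW ?orbT.
have rE : hit_rate h = c%:R / m.+1%:R.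
  rewrite /hit_rate /mean card_ord -natr_sum; congr (_%:R / _).
  have inj : injective (widen_ord c1) by move=> y z [] /val_inj.
  transitivity #|[set u : 'I_m.+1 | (u < c)%N]|.
    rewrite -sum1_card big_mkcond /= [RHS]big_mkcond /=; apply: eq_bigr => u _.
    rewrite inE /hit -/(T h) /c ltnS leq_divRL //.
    have -> : (u * T h < lam * m.+1)%N = (u * T h <= (lam * m.+1).-1)%N.
      by rewrite -[in LHS](prednK (n := lam * m.+1)) ?ltnS // muln_gt0 lam_gt0.
    by case: (_ <= _)%N.
  rewrite -[RHS](card_ord c) -(card_imset _ inj).
  congr #|pred_of_set _|; apply/setP => u; rewrite inE; apply/idP/imsetP => [uc|[y _ ->]].
    by exists (Ordinal uc) => //; apply/val_inj.
  by rewrite /= ltn_ord.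
have cT : (lam * m.+1 <= c * T h)%N.
  have := ltn_ceil (lam * m.+1).-1 T0; rewrite -/c; lia.
have cT2 : (c * T h <= 2 * (lam * m.+1))%N.
  have := leq_divM (lam * m.+1).-1 (T h); rewrite /c mulSn.
  have : (T h <= lam * m.+1)%N.
    by apply: leq_trans Tm _; apply: leq_trans (leqnSn _) _; rewrite leq_pmull.
  lia.
rewrite rE; apply/andP; split.
  by rewrite ler_pdivrMr ?ltr0n // mulrAC ler_pdivlMr ?ltr0n // -!natrM ler_nat.
rewrite ler_pdivrMr ?ltr0n // mulrAC ler_pdivlMr ?ltr0n // -!natrM ler_nat.
by rewrite -mulnA.
Qed.

Lemma hits_all (w : coins P) : (T (w None).1 <= lam)%N -> hits w g j s = N (w None).1.
Proof.
move=> Tl; rewrite /hits /N /W -sum1_card; apply: eq_bigr => e _.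
rewrite /hit -/(T _) -[X in nat_of_bool X]/(_ < _)%N.
set u := (_ e.2); have -> // : (u * T (w None).1 < lam * m.+1)%N.
apply: (@leq_ltn_trans (u * lam)); first by rewrite leq_mul2l Tl orbT.
by rewrite mulnC ltn_pmul2l.
Qed.

Definition missed (w : coins P) : bool :=
  (0 < A (w None).1 g j v)%N && (hits w g j s < hits_needed m A lam (w None).1 g j)%N.

Lemma mean_missed : mean (fun w : coins P => (missed w)%:R : R) <= 2 * expR (- lam%:R / 4).
Proof.
(* If [S] counts the hits then [S <= 1] is bounded by [2 * 2^-S], a product of
   independent factors. *)
pose phi h : R := 2 * (lam < T h <= v)%N%:R.
pose f h (e : 'I_k * key n m G) (u : coin m) : R := if hit A lam h g j u then 1 / 2 else 1.
apply: (@le_trans _ _ (mean (fun w : coins P => phi (w None).1 *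
    \prod_(e in W (w None).1) f (w None).1 e ((w (Some e.1)).2 e.2)))).
  apply: mean_le => w; rewrite /missed; set h := (w None).1.
  have f0 : 0 <= \prod_(e in W h) f h e ((w (Some e.1)).2 e.2).
    by apply: prodr_ge0 => e _; rewrite /f; case: ifP => _; lra.
  case: (boolP (_ && _)) => [/andP[/T_le Tv hn]|_]; last first.
    by rewrite mulr_ge0 // /phi mulr_ge0.
  (* A jump up to [lam] is never missed: every arrival is visible and a hit, and one hit
     suffices. *)
  have lT : (lam < T h)%N.
    rewrite ltnNge; apply/negP => Tl.
    move: hn; rewrite hits_all -/h // card_window ?(leq_trans Tv v_le_m) //.
    rewrite /hits_needed /offset -/(T h) Tl.
    under eq_bigr do rewrite subn0.
    by rewrite ltnNge (leq_trans (T_gt0 h) Tv).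
  have h1 : (hits w g j s <= 1)%N by move: hn; rewrite /hits_needed -/(T _) -/h [(T h <= lam)%N]leqNgt lT.
  have -> : \prod_(e in W h) f h e ((w (Some e.1)).2 e.2) = (1 / 2) ^+ hits w g j s.
    rewrite -prodrXr; apply: eq_bigr => e _; rewrite /f.
    by case: (hit _ _ _ _ _ _); rewrite ?expr1 ?expr0.
  rewrite /phi lT Tv /=; move: h1; case: (hits _ _ _ _) => [|[|]] //= _; rewrite ?expr0 ?expr1; lra.
rewrite (@mean_coins_in _ _ _ _ _ (ord0 : coin m) phi W f).
apply: mean_le_cst => [|h]; first by rewrite mulr_ge0 ?expR_ge0.
rewrite /phi; case: (boolP (_ < _ <= _)%N) => [/andP[lT Tv]|_]; last first.
  by rewrite mulr0 mul0r mulr_ge0 ?expR_ge0.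
rewrite mulr1 ler_wpM2l //.
have Tm : (T h <= m)%N := leq_trans Tv v_le_m.
have /andP[rho_ge _] : lam%:R / (T h)%:R <= hit_rate h <= 2 * lam%:R / (T h)%:R.
  by apply: hit_rateE; rewrite lT.
have fE e : mean (f h e) = 1 - hit_rate h / 2.
  transitivity (mean (fun u : coin m => 1 + (- (1 / 2)) * (hit A lam h g j u)%:R : R)).
    by apply: eq_mean => u; rewrite /f; case: hit => /=; lra.
  by rewrite meanD meanZ (mean_cst (ord0 : coin m)) -/(hit_rate h); lra.
under eq_bigr do rewrite fE.
rewrite prodr_const -/(N h).
have rho0 : 0 <= hit_rate h by apply: mean_ge0 => u.
have rho1 : hit_rate h <= 1 by apply: mean_le_cst => // u; case: hit.
(* Since [T h <= 2 * N h] and [lam <= hit_rate h * T h], the resulting exponent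
   [N h * hit_rate h / 2] is at least [lam / 4]. *)
apply: (@le_trans _ _ (expR (- (hit_rate h / 2)) ^+ N h)).
  rewrite lerXn2r ?nnegrE ?expR_ge0 //; first by lra.
  by have := expR_ge1Dx (- (hit_rate h / 2)); lra.
rewrite -expRM_natl ler_expR mulrN -mulr_natl.
have H : (T h)%:R <= 2 * (N h)%:R :> R.
  by rewrite -natrM ler_nat card_window_ge // lT.
have T0 : 0 < (T h)%:R :> R by rewrite ltr0n T_gt0.
have : lam%:R <= hit_rate h * (T h)%:R by rewrite -ler_pdivrMr.
have : hit_rate h * (T h)%:R <= hit_rate h * (2 * (N h)%:R) by rewrite ler_wpM2l.
nra.
Qed.

Lemma mean_hit2 (phi : hash -> R) (e e' : 'I_k * key n m G) : e != e' ->
  mean (fun w : coins P => phi (w None).1 *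
    ((hit A lam (w None).1 g j ((w (Some e.1)).2 e.2))%:R *
     (hit A lam (w None).1 g j ((w (Some e'.1)).2 e'.2))%:R)) =
  mean (fun h => phi h * hit_rate h ^+ 2).
Proof.
move=> ee'.
have := @mean_coins_in R _ _ _ _ (ord0 : coin m) phi (fun _ => [set e; e'])
  (fun h _ u => (hit A lam h g j u)%:R).
under eq_mean => w do rewrite big_setU1 ?inE // big_set1.
move=> ->; apply: eq_mean => h; rewrite big_setU1 ?inE // big_set1.
by rewrite expr2.
Qed.

Lemma mean_hit1 (phi : hash -> R) (e : 'I_k * key n m G) :
  mean (fun w : coins P => phi (w None).1 *
    (hit A lam (w None).1 g j ((w (Some e.1)).2 e.2))%:R) =
  mean (fun h => phi h * hit_rate h).
Proof.
have := @mean_coins_in R _ _ _ _ (ord0 : coin m) phi (fun _ => [set e])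
  (fun h _ u => (hit A lam h g j u)%:R).
under eq_mean => w do rewrite big_set1.
by move=> ->; apply: eq_mean => h; rewrite big_set1.
Qed.

Lemma hit_rate_ge0 h : 0 <= hit_rate h.
Proof. by apply: mean_ge0 => u. Qed.

(** For jumps above [lam], with [S] hits, the indicator of [2 <= S] is at most [S ^+ 2 - S], the
    number of ordered pairs of distinct hits; its mean involves only two independent coins at a
    time. *)
Lemma mean_hits_cost (K : R) : 0 <= K ->
  mean (fun w : coins P => (hits w g j s)%:R +
      K * (hits_needed m A lam (w None).1 g j <= hits w g j s)%N%:R) <=
  mean (fun h => if (T h <= lam)%N then (1 + K) * (N h)%:R
                 else (N h)%:R * hit_rate h + K * ((N h)%:R * hit_rate h) ^+ 2).
Proof.
move=> K0.
pose b (w : coins P) (e : 'I_k * key n m G) : R :=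
  (hit A lam (w None).1 g j ((w (Some e.1)).2 e.2))%:R.
pose phi0 h : R := if (T h <= lam)%N then (1 + K) * (N h)%:R else 0.
pose phi1 e h : R := ((lam < T h)%N && (e \in W h))%:R.
pose phi2 e e' h : R := K * (phi1 e h * phi1 e' h).
apply: (@le_trans _ _ (mean (fun w : coins P => phi0 (w None).1 +
   (\sum_e phi1 e (w None).1 * b w e +
    \sum_e \sum_(e' | e != e') phi2 e e' (w None).1 * (b w e * b w e'))))).
  apply: mean_le => w; set h := (w None).1; rewrite /phi0.
  case: (leqP (T h) lam) => Tl.
    rewrite big1 ?add0r; last by move=> e _; rewrite /phi1 ltnNge Tl mul0r.
    rewrite big1 ?addr0; last first.
      by move=> e _; rewrite big1 // => e' _; rewrite /phi2 /phi1 ltnNge Tl !(mul0r, mulr0).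
    rewrite hits_all // /hits_needed -/(T _) -/h Tl mulrDl mul1r lerD2l ler_wpM2l //.
    by rewrite ler_nat; case: (N h).
  rewrite add0r /hits_needed -/(T _) -/h [(T h <= lam)%N]leqNgt Tl /=.
  have SE : (hits w g j s)%:R = \sum_e phi1 e h * b w e.
    rewrite /hits natr_sum [LHS]big_mkcond /=; apply: eq_bigr => e _.
    by rewrite /phi1 Tl /=; case: ifP => _; rewrite ?mul1r ?mul0r.
  rewrite -SE lerD2l.
  have -> : \sum_e \sum_(e' | e != e') phi2 e e' h * (b w e * b w e') =
      K * ((hits w g j s)%:R ^+ 2 - (hits w g j s)%:R).
    rewrite mulrBr expr2 {1 2}SE mulr_suml mulr_sumr SE mulr_sumr -sumrB.
    apply: eq_bigr => e _; rewrite mulr_sumr mulr_sumr [X in _ = X - _](bigD1 e) //=.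
    have -> : K * (phi1 e h * b w e * (phi1 e h * b w e)) = K * (phi1 e h * b w e).
      congr (_ * _); rewrite /phi1 /b; case: (_ && _) => /=; case: (hit _ _ _ _ _ _) => /=; ring.
    rewrite addrAC subrr add0r; apply: eq_big => [e'|e' _]; first by rewrite eq_sym.
    by rewrite /phi2; ring.
  case: (leqP 2 (hits w g j s)) => H /=.
    rewrite mulr1 -[leLHS]mulr1 ler_wpM2l //.
    have : 2 <= (hits w g j s)%:R :> R by rewrite (ler_nat _ 2).
    nra.
  rewrite mulr0; case: (hits w g j s) H => [|[|]] //= _; rewrite ?expr0n ?expr1n /= ?subrr ?mulr0 //.
rewrite meanD (mean_hash _ _ (ord0 : coin m) phi0) meanD !mean_sum.
have -> : \sum_e mean (fun w : coins P => phi1 e (w None).1 * b w e) =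
    mean (fun h => \sum_e phi1 e h * hit_rate h).
  by rewrite mean_sum; apply: eq_bigr => e _; rewrite mean_hit1.
have -> : \sum_e mean (fun w : coins P => \sum_(e' | e != e') phi2 e e' (w None).1 * (b w e * b w e')) =
    mean (fun h => \sum_e \sum_(e' | e != e') phi2 e e' h * hit_rate h ^+ 2).
  rewrite mean_sum; apply: eq_bigr => e _; rewrite !mean_sum; apply: eq_bigr => e' ee'.
  by rewrite (mean_hit2 (phi2 e e')).
rewrite -!meanD; apply: mean_le => h; rewrite -mulr_suml.
have S1 : \sum_e phi1 e h = (lam < T h)%N%:R * (N h)%:R.
  rewrite /N -sum1_card natr_sum mulr_sumr [RHS]big_mkcond /=; apply: eq_bigr => e _.
  by rewrite /phi1; case: (_ < _)%N; case: (_ \in _); rewrite /= ?mulr1 ?mulr0.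
have S2 : \sum_e \sum_(e' | e != e') phi2 e e' h * hit_rate h ^+ 2 <=
    K * ((lam < T h)%N%:R * (N h)%:R * hit_rate h) ^+ 2.
  have -> : K * ((lam < T h)%N%:R * (N h)%:R * hit_rate h) ^+ 2 =
      K * ((\sum_e phi1 e h) * (\sum_e phi1 e h)) * hit_rate h ^+ 2 by rewrite S1; ring.
  rewrite mulr_suml mulr_sumr mulr_suml; apply: ler_sum => e _.
  rewrite mulr_sumr mulr_sumr mulr_suml [leRHS](bigID (fun e' => e != e')) /=.
  rewrite lerDl; apply: sumr_ge0 => e' _.
  by rewrite mulr_ge0 ?sqr_ge0 // mulr_ge0 // mulr_ge0 // /phi1 ler0n.
rewrite S1; apply: le_trans (lerD (lexx _) (lerD (lexx _) S2)) _.
rewrite /phi0; case: (leqP (T h) lam) => Tl /=; rewrite ?mul0r ?mul1r ?add0r //.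
by rewrite expr0n /= mulr0 !addr0.
Qed.

(** The source of the exponent [p - 1]: with [Y = 2 * k * v / T] the mean number of hits is at most
    [lam * Y / k], so its square times the poll cost [k] is of order [Y ^+ 2 / k], while the power
    [p] of [Y] contains the power [p] of [k]. For jumps up to [lam] the bounds [N <= v] and
    [T <= lam] suffice. *)
Lemma hits_cost_bound (p K0 : R) h : 2 <= p -> 0 <= K0 ->
  (if (T h <= lam)%N then (1 + K0 * k%:R) * (N h)%:R
   else (N h)%:R * hit_rate h + K0 * k%:R * ((N h)%:R * hit_rate h) ^+ 2) <=
  ((1 + K0) * lam%:R `^ p + (lam%:R + K0 * lam%:R ^+ 2) * 2 `^ p) * k%:R `^ (p - 1) *
  ((T h <= m)%N%:R * (v%:R / (T h)%:R) `^ p).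
Proof.
move=> p2 K00.
have k1 : 1 <= k%:R :> R by rewrite (ler_nat _ 1).
have l1 : 1 <= lam%:R :> R by rewrite (ler_nat _ 1).
have T0 : 0 < (T h)%:R :> R by rewrite ltr0n T_gt0.
have kp : k%:R <= k%:R `^ (p - 1) :> R.
  by rewrite -[leLHS]powRr1 // ler_powR //; lra.
have C0 : 0 <= ((1 + K0) * lam%:R `^ p + (lam%:R + K0 * lam%:R ^+ 2) * 2 `^ p) * k%:R `^ (p - 1).
  rewrite mulr_ge0 ?powR_ge0 // addr_ge0 // mulr_ge0 ?powR_ge0 //; first by lra.
  by rewrite addr_ge0 // mulr_ge0 // sqr_ge0.
have [N0|Npos] := posnP (N h).
  by rewrite N0 mul0r mulr0 expr0n /= mulr0 addr0 if_same mulr_ge0 // mulr_ge0 ?powR_ge0.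
have Tm : (T h <= m)%N.
  by rewrite leqNgt; apply/negP => /window_empty W0; rewrite /N W0 cards0 in Npos.
have v1 : 1 <= v%:R :> R by rewrite (ler_nat _ 1) (leq_trans Npos) // card_window_le.
have Nv : (N h)%:R <= v%:R :> R by rewrite ler_nat card_window_le.
rewrite Tm mul1r; set Xr := (v%:R / (T h)%:R) `^ p.
have Xr0 : 0 <= Xr by rewrite powR_ge0.
case: (leqP (T h) lam) => Tl.
  have H1 : v%:R <= lam%:R `^ p * Xr.
    rewrite -powRM ?divr_ge0 //; apply: (@le_trans _ _ (v%:R `^ p)).
      by rewrite -[leLHS]powRr1 // ler_powR //; lra.
    apply: ge0_ler_powR; rewrite ?nnegrE ?mulr_ge0 ?invr_ge0 //; first by lra.
    by rewrite mulrCA; apply: ler_peMr => //; rewrite ler_pdivlMr // mul1r ler_nat.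
  have H2 : 1 + K0 * k%:R <= (1 + K0) * k%:R `^ (p - 1).
    rewrite mulrDl mul1r lerD //; first exact: le_trans kp.
    by rewrite ler_wpM2l.
  apply: (@le_trans _ _ ((1 + K0) * k%:R `^ (p - 1) * (lam%:R `^ p * Xr))).
    apply: ler_pM => //; last exact: le_trans H1.
    by rewrite addr_ge0 // mulr_ge0 //; lra.
  rewrite [leRHS]mulrAC -subr_ge0.
  have -> : ((1 + K0) * lam%:R `^ p + (lam%:R + K0 * lam%:R ^+ 2) * 2 `^ p) * Xr * k%:R `^ (p - 1) -
    (1 + K0) * k%:R `^ (p - 1) * (lam%:R `^ p * Xr) =
    (lam%:R + K0 * lam%:R ^+ 2) * 2 `^ p * Xr * k%:R `^ (p - 1) by ring.
  by rewrite !mulr_ge0 ?powR_ge0 // addr_ge0 // mulr_ge0 // sqr_ge0.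
have /andP[_ rho_le] : lam%:R / (T h)%:R <= hit_rate h <= 2 * lam%:R / (T h)%:R.
  by apply: hit_rateE; rewrite Tl.
(* As [1 <= Y], the powers [Y] and [Y ^+ 2] are at most [Y `^ p]. *)
pose Y : R := 2 * k%:R * v%:R / (T h)%:R.
have Y1 : 1 <= Y.
  by rewrite ler_pdivlMr // mul1r -!natrM ler_nat card_window_gt0.
have YX : Y `^ p = 2 `^ p * k%:R `^ p * Xr.
  have -> : Y = 2 * k%:R * (v%:R / (T h)%:R) by rewrite /Y mulrA.
  by rewrite (@powRM _ (2 * k%:R)) ?mulr_ge0 ?invr_ge0 // [X in X * _ = _]powRM.
have kk : k%:R `^ p = k%:R `^ (p - 1) * k%:R :> R.
  rewrite -[X in _ * X]powRr1 // -powRD; first by congr (_ `^ _); lra.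
  by apply/implyP => _; rewrite pnatr_eq0 -lt0n.
have k0 : 0 < k%:R :> R by rewrite ltr0n.
have NY : (N h)%:R * hit_rate h <= lam%:R * Y / k%:R.
  apply: (@le_trans _ _ (v%:R * (2 * lam%:R / (T h)%:R))).
    by apply: ler_pM => //; exact: hit_rate_ge0.
  rewrite le_eqVlt; apply/orP; left; apply/eqP; rewrite /Y; field.
  by rewrite !pnatr_eq0 -!lt0n k_gt0 T_gt0.
have Nr0 : 0 <= (N h)%:R * hit_rate h by rewrite mulr_ge0 // hit_rate_ge0.
have Y2 : Y ^+ 2 <= Y `^ p by rewrite -powR_mulrn ?ler_powR //; lra.
have Yp : Y <= Y `^ p by rewrite -[leLHS]powRr1 ?ler_powR //; lra.
have NY2 : ((N h)%:R * hit_rate h) ^+ 2 <= (lam%:R * Y / k%:R) ^+ 2.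
  by rewrite lerXn2r ?nnegrE // (le_trans Nr0).
apply: (@le_trans _ _ (lam%:R * Y / k%:R + K0 * k%:R * (lam%:R * Y / k%:R) ^+ 2)).
  by rewrite lerD // ler_wpM2l // mulr_ge0.
have -> : lam%:R * Y / k%:R + K0 * k%:R * (lam%:R * Y / k%:R) ^+ 2 =
    (lam%:R * Y + K0 * lam%:R ^+ 2 * Y ^+ 2) / k%:R.
  by field; rewrite pnatr_eq0 -lt0n.
apply: (@le_trans _ _ ((lam%:R + K0 * lam%:R ^+ 2) * Y `^ p / k%:R)).
  rewrite ler_wpM2r ?invr_ge0 // mulrDl lerD // ler_wpM2l //.
  by rewrite mulr_ge0 // sqr_ge0.
rewrite YX kk.
have -> : (lam%:R + K0 * lam%:R ^+ 2) * (2 `^ p * (k%:R `^ (p - 1) * k%:R) * Xr) / k%:R =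
   (lam%:R + K0 * lam%:R ^+ 2) * 2 `^ p * k%:R `^ (p - 1) * Xr.
  by field; rewrite pnatr_eq0 -lt0n.
rewrite ler_wpM2r // ler_wpM2r ?powR_ge0 // lerDr mulr_ge0 ?powR_ge0 //; lra.
Qed.

Lemma mean_due_cost X (p K0 : R) : 2 <= p -> K0 = 25 * X.+1%:R ->
  mean (fun w : coins P => (due_cost X w s g j)%:R) <=
  ((1 + K0) * lam%:R `^ p + (lam%:R + K0 * lam%:R ^+ 2) * 2 `^ p) * k%:R `^ (p - 1) *
    mean (fun h => (T h <= m)%N%:R * (v%:R / (T h)%:R) `^ p) +
  K0 * k%:R * mean (fun h => (A h g j v)%:R).
Proof.
move=> p2 K0E; have K00 : 0 <= K0 by rewrite K0E mulr_ge0.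
apply: (@le_trans _ _ (mean (fun w : coins P => ((hits w g j s)%:R +
      K0 * k%:R * (hits_needed m A lam (w None).1 g j <= hits w g j s)%N%:R) +
      K0 * k%:R * (A (w None).1 g j v)%:R))).
  apply: mean_le => w; rewrite /due_cost natrD -addrA lerD2l -mulrDr -/v.
  rewrite natrM !natrM K0E; set b := (_ <= _)%N; rewrite -[_.+1%:R in X in _ * X]natr1.
  case: b => /=; rewrite ?mul1r ?mul0r; last by rewrite add0r !mulr_ge0.
  by rewrite le_eqVlt; apply/orP; left; apply/eqP; ring.
rewrite meanD lerD //.
  apply: le_trans (mean_hits_cost _) _; first by rewrite mulr_ge0.
  by rewrite -meanZ; apply: mean_le => h; exact: hits_cost_bound.
by rewrite meanZ (mean_hash _ _ (ord0 : coin m) (fun h => (A h g j v)%:R)).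
Qed.

End ExpectedCost.

(** * Tracking the moment *)

Section MomentTracker.
Variables (R : realType) (p : R) (k n m G L : nat) (F : finFieldType) (x : 'I_n -> F).
Variable tau : 'I_G -> R.
Hypotheses (p_ge2 : 2 <= p) (k_gt0 : (0 < k)%N) (x_inj : injective x) (card_F : #|F| = (2 ^ L)%N).
Hypotheses (tau_gt0 : forall g, 0 < tau g).

Let M : R := #|F|%:R.

(** An integer numerator over the denominator [#|F|]: the ratio falls short of [v ^ p / tau] by at
    most [1 / #|F|]. *)
Definition scaled (g : 'I_G) (v : nat) : nat := Num.truncn (#|F|%:R * v%:R `^ p / tau g).

Definition rounded (h : (F * F)%type) (g : 'I_G) (j : 'I_n) (v : nat) : nat :=
  round_up #|F| (scaled g v) (hash_rank x h j).

Lemma p_gt0 : 0 < p. Proof. by have := p_ge2; lra. Qed.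

Lemma M_gt0 : 0 < M. Proof. by rewrite ltr0n card_F_gt0. Qed.

Lemma scaled_arg_ge0 g v : 0 <= #|F|%:R * v%:R `^ p / tau g.
Proof. by rewrite divr_ge0 ?mulr_ge0 ?powR_ge0 // ltW. Qed.

Lemma powR_homo : {homo (fun v : nat => v%:R `^ p : R) : u v / (u <= v)%N >-> u <= v}.
Proof.
move=> u v uv; apply: ge0_ler_powR; rewrite ?nnegrE ?ler_nat //.
exact/ltW/p_gt0.
Qed.

Lemma rounded_homo h g j : {homo rounded h g j : u v / (u <= v)%N}.
Proof.
move=> u v uv; apply: leq_div2r; rewrite leq_add2r; apply: le_truncn.
by rewrite ler_wpM2r ?invr_ge0 ?(ltW (tau_gt0 g)) // ler_wpM2l // powR_homo.
Qed.

Lemma rounded0 h g j : rounded h g j 0 = 0%N.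
Proof.
rewrite /rounded /round_up /scaled powR0 ?gt_eqF ?p_gt0 // mulr0 mul0r truncn0.
by rewrite divn_small // ltn_ord.
Qed.

Lemma scaled_le g v : (scaled g v)%:R / M <= v%:R `^ p / tau g.
Proof.
rewrite ler_pdivrMr ?M_gt0 // mulrC mulrA truncn_le; exact: scaled_arg_ge0.
Qed.

Lemma scaled_ge g v : v%:R `^ p / tau g - M^-1 <= (scaled g v)%:R / M.
Proof.
have := truncn_itv (scaled_arg_ge0 g v); rewrite -/(scaled g v) => /andP[_ /ltW].
rewrite -natr1 lerBlDr => H.
rewrite -[X in _ <= _ + X]mul1r -mulrDl ler_pdivlMr ?M_gt0 //.
by rewrite mulrC mulrA.
Qed.

Lemma mean_rounded g j v :
  mean (fun h => (rounded h g j v)%:R : R) <= v%:R `^ p / tau g.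
Proof.
apply: le_trans (scaled_le g v).
rewrite /rounded (mean_hashed x (fun y => (round_up #|F| (scaled g v) y)%:R)).
by rewrite mean_round_up // card_F_gt0.
Qed.

(** At the first jump [T] the rounded value is positive, which forces
    [#|F| - hash_rank <= #|F| * T ^ p / tau]. As the rank is uniform, the mean is controlled by a
    harmonic sum. *)
Lemma mean_jump_ratio g j v :
  mean (fun h => (first_jump m rounded h g j <= m)%N%:R *
    (v%:R / (first_jump m rounded h g j)%:R) `^ p) <= L.+1%:R * (v%:R `^ p / tau g).
Proof.
have M0 := M_gt0.
apply: (@le_trans _ _ (mean (fun h =>
    v%:R `^ p / tau g * (#|F|%:R / (#|F| - hash_rank x h j)%:R)))).
  apply: mean_le => h; case: (leqP (first_jump m rounded h g j) m) => Tm /=; last first.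
    by rewrite mul0r mulr_ge0 ?divr_ge0 ?powR_ge0 // ltW.
  rewrite mul1r; set T := first_jump m rounded h g j.
  have yM : (hash_rank x h j < #|F|)%N by rewrite /hash_rank ltn_ord.
  have T0 : (0 < T)%N by exact: next_jump_gt.
  have : (0 < rounded h g j T)%N.
    by have := @after_jump m _ (@rounded_homo h g j) 0 T Tm (leqnn _); rewrite rounded0.
  rewrite divn_gt0 ?card_F_gt0 // addnC -leq_subLR => H.
  have {}H : (#|F| - hash_rank x h j)%:R <= M * T%:R `^ p / tau g.
    by rewrite -truncn_ge_nat ?scaled_arg_ge0.
  have Tp : 0 < T%:R `^ p by rewrite powR_gt0 // ltr0n.
  rewrite powRM ?invr_ge0 // -mulrA ler_wpM2l ?powR_ge0 //.
  rewrite -powR_inv1 // powRAC powR_inv1 ?powR_ge0 //.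
  rewrite -[leLHS]mul1r ler_pdivrMr // mulrAC.
  rewrite mulrA ler_pdivlMr ?ltr0n ?subn_gt0 // mul1r.
  by move: H; rewrite -/M; congr (_ <= _); ring.
rewrite meanZ mulrC ler_wpM2r ?divr_ge0 ?powR_ge0 ?(ltW (tau_gt0 g)) //.
rewrite (mean_hashed x (fun y => #|F|%:R / (#|F| - y)%:R)) card_F.
exact: harmonic_le.
Qed.

(** Fluctuation plus bias. Truncation loses at most [1 / #|F|] per item, so for [n <= #|F|] the bias
    is at most [tau g]; the factors [2] come from squaring a sum. *)
Lemma rounded_second_moment g (v : 'I_n -> nat) : (n <= 2 ^ L)%N ->
  mean (fun h => (tau g * (\sum_j rounded h g j (v j))%:R - \sum_j (v j)%:R `^ p) ^+ 2) <=
  2 * tau g * (\sum_j (v j)%:R `^ p) + 2 * tau g ^+ 2.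
Proof.
move=> nL; have t0 := tau_gt0 g; have M0 := M_gt0.
set Fp := \sum_j (v j)%:R `^ p.
pose S := \sum_j (scaled g (v j))%:R / M.
pose D (h : F * F) := \sum_j ((rounded h g j (v j))%:R - (scaled g (v j))%:R / M).
have DE h : (\sum_j rounded h g j (v j))%:R = D h + S.
  by rewrite /D sumrB /S subrK natr_sum.
have S_le : S <= Fp / tau g.
  by rewrite /S /Fp mulr_suml; apply: ler_sum => j _; exact: scaled_le.
have S_ge : Fp / tau g - 1 <= S.
  apply: (@le_trans _ _ (\sum_(j < n) ((v j)%:R `^ p / tau g - M^-1))).
    rewrite sumrB -mulr_suml lerD2l lerN2 sumr_const card_ord -[_ *+ _]mulr_natr mulrC.
    by rewrite ler_pdivrMr // mul1r ler_nat card_F.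
  by apply: ler_sum => j _; exact: scaled_ge.
have b : (tau g * S - Fp) ^+ 2 <= tau g ^+ 2.
  have E : tau g * S - Fp = tau g * (S - Fp / tau g).
    by rewrite mulrBr mulrCA divff ?gt_eqF // mulr1.
  rewrite E exprMn -[leRHS]mulr1 ler_wpM2l ?sqr_ge0 //; nra.
apply: (@le_trans _ _ (mean (fun h => 2 * tau g ^+ 2 * D h ^+ 2 + 2 * tau g ^+ 2))).
  apply: mean_le => h; rewrite DE; move: b; have := sqr_ge0 (tau g * D h - (tau g * S - Fp)); nra.
rewrite meanD (mean_cst (0 : F * F)) lerD2r meanZ.
have H : mean (fun h => D h ^+ 2) <= S by exact: hashed_sum_var.
apply: (@le_trans _ _ (2 * tau g ^+ 2 * (Fp / tau g))).
  by apply: ler_wpM2l; [rewrite mulr_ge0 ?sqr_ge0|exact: le_trans H S_le].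
by rewrite le_eqVlt; apply/orP; left; apply/eqP; field; rewrite gt_eqF.
Qed.

(** * Choice of the parameters and the success probability *)

Variables (l X lam Bud : nat) (eps kap : R).
Hypotheses (l_gt0 : (0 < l)%N) (card_up : (#|{: up_msg n m G}| <= 2 ^ l)%N)
  (card_down : (#|{: down_msg n m G (F * F)%type}| <= 2 ^ l)%N).
Hypotheses (lam_ge : (4 * (L + G + 5) <= lam)%N) (m_lt : (m.+1 <= 2 ^ X)%N) (n_le : (n <= 2 ^ L)%N).
Hypotheses (eps_gt0 : 0 < eps) (eps_lt1 : eps < 1) (kap_ge : 108 * G%:R <= kap).
Hypothesis tauE : forall g, tau g = eps ^+ 2 * 2 ^+ g / kap.

Let P : protocol R k n := tracker k m l rounded lam Bud tau.

Let K0 : R := 25 * X.+1%:R.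

(** The factor [L.+1] is the harmonic bound for the random first jump; the final [K0] pays for the
    polls driven by the later jumps. *)
Definition cost_factor : R :=
  ((1 + K0) * lam%:R `^ p + (lam%:R + K0 * lam%:R ^+ 2) * 2 `^ p) * L.+1%:R + K0.

Hypothesis Bud_gt : 9 * cost_factor * k%:R `^ (p - 1) * kap / eps ^+ 2 <= Bud.+1%:R.

Lemma lam_gt0 : (0 < lam)%N. Proof. by move: lam_ge; lia. Qed.

Lemma cost_factor_ge0 : 0 <= cost_factor.
Proof.
have K00 : 0 <= K0 by rewrite mulr_ge0.
rewrite addr_ge0 // mulr_ge0 // addr_ge0 // mulr_ge0 ?powR_ge0 //; first lra.
by rewrite addr_ge0 // mulr_ge0 // sqr_ge0.
Qed.

Lemma mean_total_cost g (s : stream k n) : (size s <= m)%N ->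
  mean (fun w : coins P => (\sum_j due_cost X w s g j)%N%:R) <=
  cost_factor * k%:R `^ (p - 1) * (moment p s / tau g).
Proof.
move=> sm; rewrite /moment mulr_suml mulr_sumr.
under eq_mean => w do rewrite natr_sum.
rewrite mean_sum; apply: ler_sum => j _.
have k1 : 1 <= k%:R :> R by rewrite (ler_nat _ 1).
have kp : k%:R <= k%:R `^ (p - 1) :> R.
  by rewrite -[leLHS]powRr1 // ler_powR //; have := p_ge2; lra.
have K00 : 0 <= K0 by rewrite mulr_ge0.
apply: le_trans (mean_due_cost l rounded Bud tau k_gt0 lam_gt0 g j sm p_ge2 (erefl K0)) _.
set y := (freq s j)%:R `^ p / tau g.
have y0 : 0 <= y by rewrite divr_ge0 ?powR_ge0 // ltW.
set C1 := (1 + K0) * _ + _.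
have C10 : 0 <= C1.
  rewrite addr_ge0 // mulr_ge0 ?powR_ge0 //; first lra.
  by rewrite addr_ge0 // mulr_ge0 // sqr_ge0.
have H1 := mean_jump_ratio g j (freq s j); have H2 := mean_rounded g j (freq s j).
apply: (@le_trans _ _ (C1 * k%:R `^ (p - 1) * (L.+1%:R * y) + K0 * k%:R `^ (p - 1) * y)).
  apply: lerD; first by rewrite ler_wpM2l // mulr_ge0 ?powR_ge0.
  apply: ler_pM => //; first by rewrite mulr_ge0.
    by apply: mean_ge0 => h.
  by rewrite ler_wpM2l.
rewrite /cost_factor -/C1 le_eqVlt; apply/orP; left; apply/eqP; ring.
Qed.

Lemma PrE (E : pred (coins P)) : Pr E = mean (fun w => (E w)%:R).
Proof.
rewrite /Pr /mean -sum1_card natr_sum big_mkcond; congr (_ / _).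
by apply: eq_bigr => w _; rewrite unfold_in; case: (E w).
Qed.

Lemma freq_eq0 (s : stream k n) j : moment p s < 1 -> freq s j = 0%N.
Proof.
move=> F1; apply/eqP; rewrite eqn0Ngt; apply: contraTN F1 => vj; rewrite -leNgt.
rewrite /moment (bigD1 j) //= -[leLHS]addr0; apply: lerD; last first.
  by apply: sumr_ge0 => i _; rewrite powR_ge0.
by have := @powR_homo 1 _ vj; rewrite powR1.
Qed.

(** Prepares a union bound over scales and items: [G * n <= 2 ^ (L + G)], and [lam] leaves a further
    factor [2 ^ 5] to spare. *)
Lemma exp_lam : 2 * (G * n)%:R * expR (- lam%:R / 4) <= 1 / 9 :> R.
Proof.
have e2 : 2 <= expR 1 :> R by have := expR_ge1Dx (1 : R); lra.
have E : expR (- lam%:R / 4) <= (2 ^ (L + G + 5))%:R^-1 :> R.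
  apply: (@le_trans _ _ (expR (- (L + G + 5)%:R))).
    rewrite ler_expR; have : (4 * (L + G + 5))%:R <= lam%:R :> R by rewrite ler_nat.
    rewrite natrM; lra.
  rewrite expRN lef_pV2 ?posrE ?expR_gt0 ?ltr0n ?expn_gt0 //.
  by rewrite -[X in expR X]mulr1 expRM_natl natrX lerXn2r ?nnegrE ?expR_ge0.
apply: (@le_trans _ _ (2 * (G * n)%:R * (2 ^ (L + G + 5))%:R^-1)).
  by rewrite ler_wpM2l // mulr_ge0.
rewrite ler_pdivrMr ?ltr0n ?expn_gt0 //.
have H : (G * n <= 2 ^ (L + G))%N.
  by rewrite expnD mulnC leq_mul // ltnW // ltn_expl.
have : (G * n)%:R <= (2 ^ (L + G))%:R :> R by rewrite ler_nat.
have -> : (2 ^ (L + G + 5))%:R = (2 ^ (L + G))%:R * 32 :> R by rewrite expnD natrM.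
have : 0 <= (2 ^ (L + G))%:R :> R by [].
lra.
Qed.

Lemma output_tracker (w : coins P) (s : stream k n) g : (size s <= m)%N ->
  (\sum_j due_cost X w s g j <= Bud)%N ->
  (forall (g' : 'I_G) j, (g' <= g)%N -> ~~ missed s g' j w) ->
  exists2 g' : 'I_G, (g' <= g)%N &
    output w s = tau g' * (\sum_j rounded (w None).1 g' j (freq s j))%:R.
Proof.
move=> sm sB nm.
apply: (output_run k_gt0 l_gt0 card_up card_down lam_gt0 m_lt rounded_homo sm sB).
move=> g' j g'g A1; have := nm g' j g'g; rewrite /missed A1 /=.
by rewrite -leqNgt.
Qed.

Lemma due_cost0 (w : coins P) (s : stream k n) g j : (size s <= m)%N ->
  freq s j = 0%N -> due_cost X w s g j = 0%N.
Proof.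
move=> sm f0; have h0 : hits w g j s = 0%N.
  apply/eqP; rewrite -leqn0 -f0.
  apply: leq_trans (card_window_le rounded lam g j sm (w None).1).
  by rewrite -sum1_card; apply: leq_sum => e _; exact: leq_b1.
rewrite /due_cost h0 leqn0 /hits_needed; case: ifP => _ //.
Qed.

(** Three kinds of failure, each of mean at most [1 / 9]: a large error at a scale up to the right
    one (Chebyshev), a missed jump, a right scale over budget (Markov). *)
Lemma tracker_correct (s : stream k n) : (size s <= m)%N -> moment p s <= 2 ^+ G.-1 ->
  (0 < G)%N -> 2 / 3 <= Pr (fun w : coins P => approximates eps (moment p s) (output w s)).
Proof.
move=> sm FG G0; set Fp := moment p s; rewrite PrE.
have coins_cst (a : R) : mean (fun _ : coins P => a) = a.
  exact: (mean_cst ([ffun => ((0, 0), [ffun => ord0])] : coins P)).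
(* Below one the moment vanishes, as all counts are zero, and the answer is zero for every seed. *)
have [F1|F1] := ltP Fp 1.
  have all0 j : freq s j = 0%N by exact: freq_eq0.
  have F0 : Fp = 0.
    rewrite /Fp /moment big1 // => j _.
    by rewrite all0 powR0 // gt_eqF // p_gt0.
  apply: (@le_trans _ _ (mean (fun _ : coins P => 1))); first by rewrite coins_cst; lra.
  apply: mean_le => w.
  have [||g' _ ->] := @output_tracker w s (Ordinal G0) sm.
  - by rewrite big1 // => j _; exact: due_cost0.
  - by move=> g' j _; rewrite /missed all0 rounded0.
  rewrite big1 ?mulr0; last by move=> j _; rewrite all0 rounded0.
  by rewrite /approximates F0 subrr normr0 mulr0 lexx.
have Fpos : 0 < Fp by lra.
(* The right scale is the least power of two that is at least [Fp]; it is at most [2 * Fp] because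
   [1 <= Fp]. *)
have exg : exists g, Fp <= 2 ^+ g by exists G.-1.
case: (ex_minnP exg) => g0 Fg0 g0min.
have g0G : (g0 < G)%N by have := g0min _ FG; lia.
have Fg0' : 2 ^+ g0 <= 2 * Fp.
  case: g0 Fg0 g0min {g0G} => [|g0] _ g0min; first by rewrite expr0; lra.
  have : ~~ (Fp <= 2 ^+ g0) by apply/negP => /g0min; rewrite ltnn.
  by rewrite -ltNge exprS; lra.
pose gs := Ordinal g0G.
have kap0 : 0 < kap by apply: lt_le_trans kap_ge; rewrite mulr_gt0 // ltr0n.
have e20 : 0 < eps ^+ 2 by rewrite exprn_gt0.
pose e g : R := ((g : 'I_G) <= gs)%N%:R.
pose sq g (h : F * F) : R := (tau g * (\sum_j rounded h g j (freq s j))%:R - Fp) ^+ 2.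
(* Whenever the output fails, [mis], [mark] or one of the [cheb g] is at least one. *)
pose cheb g (w : coins P) : R := e g / (eps ^+ 2 * Fp ^+ 2) * sq g (w None).1.
pose mis (w : coins P) : R := \sum_g \sum_j (missed s g j w)%:R.
pose mark (w : coins P) : R := Bud.+1%:R^-1 * (\sum_j due_cost X w s gs j)%N%:R.
have B0 : 0 < Bud.+1%:R :> R by rewrite ltr0n.
have cheb_ge0 g w : 0 <= cheb g w.
  by rewrite mulr_ge0 ?sqr_ge0 // divr_ge0 // mulr_ge0 // ?sqr_ge0 // ltW.
have mis_ge0 w : 0 <= mis w by apply: sumr_ge0 => g _; apply: sumr_ge0 => j _; rewrite ler0n.
have mark_ge0 w : 0 <= mark w by rewrite mulr_ge0 ?invr_ge0 ?ler0n.
have key_ineq : mean (fun w : coins P => 1) <=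
    mean (fun w : coins P => (approximates eps Fp (output w s))%:R +
      (\sum_g cheb g w + (mis w + mark w))).
  apply: mean_le => w.
  have chs0 : 0 <= \sum_g cheb g w by apply: sumr_ge0.
  have := mis_ge0 w; have := mark_ge0 w.
  case: (boolP (approximates _ _ _)) => [_|napp] /=; first lra.
  have [sB|Bs] := leqP (\sum_j due_cost X w s gs j)%N Bud; last first.
    have : 1 <= mark w by rewrite /mark mulrC ler_pdivlMr // mul1r ler_nat.
    lra.
  have [/existsP[g /existsP[j mgj]]|nmis] := boolP [exists g, exists j, missed s g j w].
    have : 1 <= mis w.
      rewrite /mis (bigD1 g) //= (bigD1 j) //= mgj -addrA lerDl.
      by rewrite addr_ge0 //; apply: sumr_ge0 => // i _; apply: sumr_ge0.
    lra.
  have [|g' g'g outE] := @output_tracker w s gs sm sB.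
    move=> g' j _; apply: contra nmis => mgj.
    by apply/existsP; exists g'; apply/existsP; exists j.
  have : 1 <= cheb g' w.
    rewrite /cheb /e g'g mulrC mulrA mulr1 ler_pdivlMr ?mulr_gt0 ?exprn_gt0 // mul1r.
    move: napp; rewrite /approximates outE -ltNge => /ltW H.
    rewrite /sq -exprMn -[leRHS]real_normK ?num_real // lerXn2r ?nnegrE ?normr_ge0 //.
    exact/ltW/mulr_gt0.
  rewrite (bigD1 g') //= => H1.
  have : 0 <= \sum_(g | g != g') cheb g w by apply: sumr_ge0.
  lra.
move: key_ineq; rewrite coins_cst meanD meanD meanD => key_ineq.
have chebE : \sum_g mean (cheb g) <= 1 / 9.
  (* From [tau g * kap <= 2 * eps ^+ 2 * Fp] and [tau g <= 2 * Fp] the second moment gives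
     [4 + 8 = 12] per scale; [108 * G <= kap] then brings the sum to [1 / 9]. *)
  apply: (@le_trans _ _ (\sum_(g < G) 12 / kap)); last first.
    rewrite sumr_const card_ord -[_ *+ _]mulr_natr mulrAC ler_pdivrMr //.
    by have := kap_ge; lra.
  apply: ler_sum => g _; rewrite /cheb meanZ.
  rewrite (mean_hash _ _ (ord0 : coin m) (sq g)).
  have t0 := tau_gt0 g; have D0 : 0 < eps ^+ 2 * Fp ^+ 2 by rewrite mulr_gt0 ?exprn_gt0.
  have sqle : mean (sq g) <= 2 * tau g * Fp + 2 * tau g ^+ 2.
    exact: (rounded_second_moment g (freq s) n_le).
  have kap1 : 1 <= kap.
    have g1 : 1 <= G%:R :> R by rewrite (ler_nat _ 1).
    by apply: le_trans kap_ge; lra.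
  rewrite /e; case: (leqP g gs) => [ggs|_]; last by rewrite !mul0r divr_ge0 // ltW.
  rewrite mul1r mulrC ler_pdivrMr //; apply: le_trans sqle _.
  have tle : tau g * kap <= 2 * eps ^+ 2 * Fp.
    rewrite tauE mulfVK ?gt_eqF // -mulrA mulrCA ler_wpM2l ?(ltW e20) //.
    by apply: le_trans Fg0'; rewrite ler_eXn2l ?ler1n //; lra.
  have e21 : eps ^+ 2 <= 1 by rewrite expr_le1 // ?ltW // ltW.
  rewrite -subr_ge0.
  have -> : 12 / kap * (eps ^+ 2 * Fp ^+ 2) - (2 * tau g * Fp + 2 * tau g ^+ 2) =
     (12 * eps ^+ 2 * Fp ^+ 2 - 2 * (tau g * kap) * Fp - 2 * (tau g * kap) * tau g) / kap.
    by field; rewrite gt_eqF.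
  rewrite divr_ge0 ?(ltW kap0) //.
  have tt : tau g <= tau g * kap by rewrite ler_pMr.
  have t2F : tau g <= 2 * Fp.
    apply: le_trans tt _; apply: le_trans tle _.
    by rewrite -mulrA ler_pM2l // -[leRHS]mul1r ler_wpM2r // ltW.
  have H1 : tau g * kap * Fp <= 2 * eps ^+ 2 * Fp * Fp by rewrite ler_wpM2r // ltW.
  have H2 : tau g * kap * tau g <= 2 * eps ^+ 2 * Fp * (2 * Fp).
    by apply: ler_pM => //; rewrite ltW // mulr_gt0.
  move: H1 H2; rewrite !expr2; lra.
have misE : mean mis <= 1 / 9.
  apply: le_trans exp_lam; rewrite /mis mean_sum.
  apply: (@le_trans _ _ (\sum_(g < G) \sum_(j < n) 2 * expR (- lam%:R / 4))); last first.
    rewrite !sumr_const !card_ord -mulrnA -[_ *+ _]mulr_natr.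
    by rewrite le_eqVlt; apply/orP; left; apply/eqP; rewrite mulnC; ring.
  apply: ler_sum => g _; rewrite mean_sum; apply: ler_sum => j _.
  exact: (mean_missed l Bud tau k_gt0 lam_gt0 rounded_homo rounded0 g j sm).
have markE : mean mark <= 1 / 9.
  rewrite /mark meanZ mulrC ler_pdivrMr //.
  apply: le_trans (mean_total_cost gs sm) _; rewrite -/Fp.
  have H : Fp / tau gs <= kap / eps ^+ 2.
    rewrite ler_pdivrMr ?tau_gt0 // tauE.
    have -> : kap / eps ^+ 2 * (eps ^+ 2 * 2 ^+ gs / kap) = 2 ^+ gs.
      by field; rewrite !gt_eqF.
    by [].
  apply: (@le_trans _ _ (cost_factor * k%:R `^ (p - 1) * (kap / eps ^+ 2))).
    by rewrite ler_wpM2l // mulr_ge0 ?powR_ge0 ?cost_factor_ge0.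
  by move: Bud_gt; rewrite !mulrA; lra.
have chebE' : mean (fun w : coins P => \sum_g cheb g w) <= 1 / 9 by rewrite mean_sum.
have {}key_ineq : 1 <= mean (fun w : coins P => (approximates eps Fp (output w s))%:R) +
  (mean (fun w : coins P => \sum_g cheb g w) + (mean mis + mean mark)) := key_ineq.
move: key_ineq chebE' misE markE; set a := mean _; set b := mean _.
move: (mean mis) (mean mark) => u v; lra.
Qed.

End MomentTracker.

(** * Message lengths and the final constants *)

Lemma card_set_ord G : #|{: {set 'I_G}}| = (2 ^ G)%N.
Proof. by rewrite -cardsT -powersetT card_powerset cardsT card_ord. Qed.

Lemma card_up_msg n m G L X l : (n <= 2 ^ L)%N -> (m < 2 ^ X)%N -> (L + G + X < l)%N ->
  (#|{: up_msg n m G}| <= 2 ^ l)%N.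
Proof.
move=> nL mX lG; rewrite card_sum card_prod card_set_ord !card_ord.
apply: (@leq_trans (2 ^ l.-1 + 2 ^ l.-1)); last by rewrite addnn -mul2n -expnS prednK //; lia.
apply: leq_add; last by apply: leq_trans mX _; rewrite leq_exp2l //; lia.
by apply: leq_trans (leq_mul nL (leqnn _)) _; rewrite -expnD leq_exp2l //; lia.
Qed.

Lemma card_down_msg n m G L X l (F : finType) : (n <= 2 ^ L)%N -> (m < 2 ^ X)%N ->
  #|F| = (2 ^ L)%N -> (2 * L + X + 2 * G + 2 <= l)%N ->
  (#|{: down_msg n m G (F * F)%type}| <= 2 ^ l)%N.
Proof.
move=> nL mX FL lG; rewrite card_sum !card_prod card_option !card_prod card_set_ord !card_ord FL.
apply: (@leq_trans (2 ^ l.-1 + 2 ^ l.-1)); last by rewrite addnn -mul2n -expnS prednK //; lia.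
apply: leq_add; first by rewrite -expnD leq_exp2l //; lia.
have H : ((m.+1 * 2 ^ G * 2 ^ G).+1 <= 2 ^ (X + 2 * G).+1)%N.
  have : (m.+1 * 2 ^ G * 2 ^ G <= 2 ^ (X + 2 * G))%N.
    by rewrite mul2n -addnn addnA !expnD !leq_mul.
  have : (0 < 2 ^ (X + 2 * G))%N by rewrite expn_gt0.
  by rewrite expnS; lia.
by apply: leq_trans (leq_mul nL H) _; rewrite -expnD leq_exp2l //; lia.
Qed.

Section Constants.
Variables (R : realType) (p : R) (P0 : nat).
Hypotheses (p_ge2 : 2 <= p) (p_le : p <= P0%:R).

Lemma powR_le_exp (x y : R) : 1 <= x -> x <= y -> x `^ p <= y ^+ P0.
Proof.
move=> x1 xy; apply: (@le_trans _ _ (x `^ P0%:R)); first by rewrite ler_powR.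
by rewrite powR_mulrn ?lerXn2r ?nnegrE //; lra.
Qed.

Lemma moment_le k n m L c (s : stream k n) : (n <= 2 ^ L)%N -> (m <= n ^ c)%N ->
  (size s <= m)%N -> moment p s <= 2 ^+ (L + c * L * P0).
Proof.
move=> nL mn sm; apply: (@le_trans _ _ (\sum_(j < n) (2 ^+ (c * L)) ^+ P0)).
  apply: ler_sum => j _.
  have b1 : 1 <= 2 ^+ (c * L) :> R by rewrite exprn_ege1 //; lra.
  apply: le_trans (powR_le_exp b1 (lexx _)).
  have p0 : 0 <= p by move: p_ge2; lra.
  apply: ge0_ler_powR; rewrite ?nnegrE ?exprn_ge0 // -natrX ler_nat.
  apply: leq_trans (freq_size _ _) _; apply: leq_trans sm _; apply: leq_trans mn _.
  by rewrite mulnC expnM; case: (c) => // c'; rewrite leq_exp2r.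
rewrite sumr_const card_ord -[_ *+ _]mulr_natl exprD (exprM _ (c * L)) ler_wpM2r ?exprn_ge0 //.
by rewrite -natrX ler_nat.
Qed.

(** The constant is [26 + 26 + 25], one part for each of the three terms of [cost_factor]. *)
Lemma cost_factor_le L X lam y : (X < y)%N -> (0 < lam <= y)%N -> (L < y)%N ->
  cost_factor p L X lam <= 77 * 2 ^+ P0 * y%:R ^+ (P0 + 4).
Proof.
move=> Xy /andP[lam0 lamy] Ly; rewrite /cost_factor.
have Y1 : 1 <= y%:R :> R by rewrite (ler_nat _ 1); lia.
set Y := y%:R : R in Y1 *.
have X' : X.+1%:R <= Y by rewrite ler_nat.
have L' : L.+1%:R <= Y by rewrite ler_nat.
have lam' : lam%:R <= Y by rewrite ler_nat.
have lam1 : 1 <= lam%:R :> R by rewrite (ler_nat _ 1).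
have x0 : 0 <= X.+1%:R :> R by [].
have l0 : 0 <= L.+1%:R :> R by [].
have H1 : lam%:R `^ p <= Y ^+ P0 by exact: powR_le_exp.
have H2 : 2 `^ p <= 2 ^+ P0 :> R by apply: powR_le_exp; lra.
have h1 : 0 <= lam%:R `^ p by rewrite powR_ge0.
have h2 : 0 <= 2 `^ p :> R by rewrite powR_ge0.
have q1 : 1 <= 2 ^+ P0 :> R by rewrite exprn_ege1 //; lra.
have Z1 : 1 <= Y ^+ P0 by rewrite exprn_ege1.
rewrite exprD; set q := 2 ^+ P0 in H2 q1 *; set Z := Y ^+ P0 in H1 Z1 *.
have Y2 : Y <= Y ^+ 3 by rewrite -[leLHS]expr1 ler_weXn2l.
have Y3 : 1 <= Y ^+ 3 by rewrite exprn_ege1.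
have Y4 : Y <= Y ^+ 4 by rewrite -[leLHS]expr1 ler_weXn2l.
have qZ : 1 <= q * Z by rewrite -[leLHS]mulr1 ler_pM.
have a1 : (1 + 25 * X.+1%:R) * lam%:R `^ p <= 26 * Y ^+ 3 * (q * Z).
  apply: (@le_trans _ _ ((26 * Y ^+ 3) * Z)).
    by apply: ler_pM => //; [lra|lra].
  by apply: ler_wpM2l; [lra|rewrite ler_peMl //; lra].
have a2 : lam%:R + 25 * X.+1%:R * lam%:R ^+ 2 <= 26 * Y ^+ 3.
  have : X.+1%:R * lam%:R ^+ 2 <= Y * Y ^+ 2.
    by apply: ler_pM => //; rewrite ?sqr_ge0 // lerXn2r ?nnegrE //; lra.
  rewrite -exprS -mulrA; lra.
have a3 : (lam%:R + 25 * X.+1%:R * lam%:R ^+ 2) * 2 `^ p <= 26 * Y ^+ 3 * (q * Z).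
  apply: (@le_trans _ _ ((26 * Y ^+ 3) * q)).
    by apply: ler_pM => //; rewrite addr_ge0 // mulr_ge0 // ?mulr_ge0 // sqr_ge0.
  by apply: ler_wpM2l; [lra|rewrite ler_peMr //; lra].
have a4 : ((1 + 25 * X.+1%:R) * lam%:R `^ p + (lam%:R + 25 * X.+1%:R * lam%:R ^+ 2) * 2 `^ p) * L.+1%:R
    <= 52 * Y ^+ 3 * (q * Z) * Y.
  apply: ler_pM => //; last lra.
  by rewrite addr_ge0 // mulr_ge0 // ?addr_ge0 ?mulr_ge0 ?sqr_ge0.
have a5 : 25 * X.+1%:R <= 25 * Y ^+ 4 * (q * Z).
  apply: (@le_trans _ _ (25 * Y ^+ 4)); first lra.
  by rewrite ler_peMr //; lra.
apply: le_trans (lerD a4 a5) _; rewrite le_eqVlt; apply/orP; left; apply/eqP; ring.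
Qed.

End Constants.

(** Both [(up_log 2 n).-1 * ln 2] and [ln 2] are at most [ln n]. *)
Lemma up_log_le_ln (R : realType) n : (1 < n)%N -> (up_log 2 n)%:R <= 2 / ln 2 * ln (n%:R : R).
Proof.
move=> n1; have l2 : 0 < ln 2 :> R by apply: ln_gt0; lra.
have n0 : 0 < n%:R :> R by rewrite ltr0n; lia.
have ln2n : ln 2 <= ln n%:R :> R by rewrite ler_ln ?posrE // ?(ler_nat _ 2) //; lra.
rewrite mulrAC ler_pdivlMr //.
have [/andP[lt _] L0] : (2 ^ (up_log 2 n).-1 < n <= 2 ^ up_log 2 n)%N /\ (0 < up_log 2 n)%N.
  by split; [exact: up_log_bounds|rewrite up_log_gt0].
have H : ln (2 ^+ (up_log 2 n).-1) <= ln n%:R :> R.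
  by rewrite ler_ln ?posrE ?exprn_gt0 // -natrX ler_nat ltnW.
move: H; rewrite lnXn //.
rewrite -[X in X%:R * _](prednK L0) -natr1 -[_ *+ _]mulr_natl mulrDl; lra.
Qed.

Theorem theorem9 (R : realType) (p : R) (hp : 2 <= p) (c : nat) :
  exists (C : R) (d : nat),
  forall (k n m : nat) (eps : R),
    (0 < k)%N -> (1 < n)%N -> (m <= n ^ c)%N -> 0 < eps < 1 ->
  exists P : protocol R k n,
    [/\ terminating P m,
        forall (s : m.-tuple ('I_k * 'I_n)) (t : nat), (t <= m)%N ->
          2 / 3 <= Pr (fun w : coins P =>
            approximates eps (moment p (take t s)) (output w (take t s)))
      & forall (w : coins P) (s : m.-tuple ('I_k * 'I_n)),
          (cost w s)%:R <= C * (k%:R `^ (p - 1) / eps ^+ 2) * ln n%:R ^+ d].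
Proof.
pose P0 := (Num.truncn p).+1.
have p_le : p <= P0%:R.
  have p0 : 0 <= p by lra.
  by have /andP[_ /ltW] := truncn_itv p0.
(* Chosen so that [y = a * L] dominates [L], [X], [G], [lam] and [l] at once. *)
pose a := (40 * (c.+1 * P0.+1))%N.
(* The budget has degree [P0 + 5] in [y]; the number [G] of scales and the message length [l] add
   one each. The number [1000 * 100] exceeds [9 * 77 * 108 + 8]. *)
exists (1000 * 100 * 2 ^+ P0 * (a%:R * (2 / ln 2)) ^+ (P0 + 7)), (P0 + 7)%N.
move=> k n m eps k0 n1 mn /andP[eps0 eps1].
pose L := up_log 2 n.
have L0 : (0 < L)%N by rewrite up_log_gt0.
have nL : (n <= 2 ^ L)%N by have /andP[] := up_log_bounds (isT : 1 < 2)%N n1.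
(* [G] is such that [2 ^ G.-1] is the bound of [moment_le], so some scale always fits the moment. *)
pose X := (c * L).+1; pose G := (L + c * L * P0).+1.
pose lam := (4 * (L + G + 5))%N; pose l := (2 * L + X + 2 * G + 3)%N.
pose y := (a * L)%N.
have mX : (m < 2 ^ X)%N.
  have mc : (m <= 2 ^ (c * L))%N.
    apply: leq_trans mn _; rewrite mulnC expnM.
    by case: (c) => // c'; rewrite leq_exp2r.
  rewrite /X expnS; have : (0 < 2 ^ (c * L))%N by rewrite expn_gt0.
  lia.
have cL : (c <= c * L)%N by rewrite leq_pmulr.
have yE : (y = 40 * (c * L * P0 + c * L + P0 * L + L))%N by rewrite /y /a; ring.
have Gy : (G <= y)%N by rewrite yE /G; lia.
have Xy : (X < y)%N by rewrite yE /X; lia.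
have lamy : (0 < lam <= y)%N by rewrite yE /lam /G; lia.
have ly : (l <= y)%N by rewrite yE /l /X /G; lia.
have Ly : (L < y)%N by rewrite yE; lia.
have G0 : (0 < G)%N by [].
have l0 : (0 < l)%N by rewrite /l; lia.
pose kap : R := 108 * G%:R.
have kap0 : 0 < kap by rewrite /kap pmulr_rgt0 ?ltr0n.
pose tau (g : 'I_G) : R := eps ^+ 2 * 2 ^+ g / kap.
have tau0 g : 0 < tau g by rewrite divr_gt0 // mulr_gt0 ?exprn_gt0 //; lra.
(* A field with exactly [2 ^ L] elements: items embed as distinct points, and [harmonic_le] applies
   to the ranks. *)
have [F _ FL] := pPrimePowerField (isT : prime 2) L0.
have nF : (n <= #|F|)%N by rewrite FL.
pose x (j : 'I_n) : F := enum_val (widen_ord nF j).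
have x_inj : injective x by move=> i j /enum_val_inj [] /val_inj.
have up_ok : (#|{: up_msg n m G}| <= 2 ^ l)%N by apply: card_up_msg nL mX _; rewrite /l; lia.
have down_ok : (#|{: down_msg n m G (F * F)%type}| <= 2 ^ l)%N.
  by apply: card_down_msg nL mX FL _; rewrite /l; lia.
pose W : R := k%:R `^ (p - 1) / eps ^+ 2.
pose B : R := 9 * cost_factor p L X lam * k%:R `^ (p - 1) * kap / eps ^+ 2.
(* Truncation gives both [Bud <= B], for the cost, and [B < Bud.+1], for Markov's inequality. *)
pose Bud := Num.truncn B.
have cf0 : 0 <= cost_factor p L X lam := cost_factor_ge0 p L X lam.
have e20 : 0 < eps ^+ 2 by rewrite exprn_gt0.
have B0 : 0 <= B by rewrite divr_ge0 ?(ltW e20) // !mulr_ge0 ?powR_ge0 ?(ltW kap0).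
have /andP[Bud_le Bud_gt] := truncn_itv B0; rewrite -/Bud in Bud_le Bud_gt.
have lam0 : (0 < lam)%N by case/andP: lamy.
exists (tracker k m l (rounded p x tau) lam Bud tau); split.
- move=> w s t tm; apply: (quiet_run k0 l0 up_ok down_ok lam0 mX (rounded_homo x hp tau0)).
  by rewrite size_take size_tuple; case: ltnP.
- move=> s t tm.
  have st : (size (take t s) <= m)%N by rewrite size_take size_tuple; case: ltnP.
  have Bud_gt' : 9 * cost_factor p L X lam * k%:R `^ (p - 1) * kap / eps ^+ 2 <= Bud.+1%:R.
    exact: ltW.
  exact: (tracker_correct hp k0 x_inj FL tau0 l0 up_ok down_ok (leqnn _) mX nL eps0 eps1
    (lexx _) (fun g => erefl _) Bud_gt' st (moment_le hp p_le nL mn st) G0).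
move=> w s.
have sm : (size s <= m)%N by rewrite size_tuple.
have costE := cost_run k0 l0 up_ok down_ok lam0 mX (rounded_homo x hp tau0) w sm.
apply: (@le_trans _ _ (l * (k + G * (Bud + 1 + 6 * k)))%N%:R); first by rewrite ler_nat.
have k1 : 1 <= k%:R :> R by rewrite (ler_nat _ 1).
have kW : k%:R <= W.
  rewrite /W ler_pdivlMr //; apply: (@le_trans _ _ k%:R).
    by rewrite ler_piMr // expr_le1 // ltW.
  by rewrite -[leLHS]powRr1 // ler_powR //; lra.
have ylog : y%:R <= a%:R * (2 / ln 2) * ln n%:R :> R.
  by rewrite /y natrM -mulrA ler_wpM2l // up_log_le_ln.
have Y1 : 1 <= y%:R :> R by rewrite (ler_nat _ 1) (leq_ltn_trans (leq0n X) Xy).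
have GY : G%:R <= y%:R :> R by rewrite ler_nat.
have lY : l%:R <= y%:R :> R by rewrite ler_nat.
have cfY := cost_factor_le hp p_le Xy lamy Ly.
clearbody y; pose q : R := 2 ^+ P0; pose V : R := y%:R ^+ (P0 + 5) * W.
have q1 : 1 <= q by rewrite /q exprn_ege1 //; lra.
have W1 : 1 <= W by lra.
have V1 : W <= V by rewrite /V ler_peMl ?exprn_ege1 //; lra.
have qV : V <= q * V by rewrite ler_peMl //; lra.
have Bud_V : Bud%:R <= 9 * 77 * 108 * (q * V).
  apply: le_trans Bud_le _.
  have -> : B = 9 * 108 * (cost_factor p L X lam * G%:R) * W.
    by rewrite /B /W /kap; ring.
  have -> : 9 * 77 * 108 * (q * V) = 9 * 108 * (77 * 2 ^+ P0 * y%:R ^+ (P0 + 4) * y%:R) * W.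
    by rewrite /V /q (_ : (P0 + 5 = (P0 + 4).+1)%N) ?exprSr; [ring | rewrite addnS].
  apply: ler_wpM2r; first lra.
  apply: ler_wpM2l; first lra.
  by apply: ler_pM.
have k_U : k%:R <= q * V by lra.
have inner : (k + G * (Bud + 1 + 6 * k))%N%:R <= 1000 * 100 * (q * V) * y%:R.
  rewrite (natrD _ k) (natrM _ G) (natrD _ (Bud + 1)%N) (natrD _ Bud) (natrM _ 6).
  have h1 : Bud%:R + 1 + 6 * k%:R <= (9 * 77 * 108 + 7) * (q * V) by lra.
  have h2 : G%:R * (Bud%:R + 1 + 6 * k%:R) <= y%:R * ((9 * 77 * 108 + 7) * (q * V)).
    apply: ler_pM => //; have : 0 <= Bud%:R :> R by [].
    by lra.
  have h3 : q * V <= y%:R * (q * V) by rewrite ler_peMl //; lra.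
  rewrite [leRHS](_ : _ = 1000 * 100 * (y%:R * (q * V))); last by ring.
  move: h2 h3 k_U; rewrite [y%:R * (_ * (q * V))]mulrCA.
  by move: (y%:R * (q * V)) => u h2 h3 h4; lra.
have ypow : y%:R ^+ (P0 + 7) <= (a%:R * (2 / ln 2)) ^+ (P0 + 7) * ln n%:R ^+ (P0 + 7) :> R.
  by rewrite -exprMn lerXn2r ?nnegrE //; lra.
rewrite natrM; apply: (@le_trans _ _ (y%:R * (1000 * 100 * (q * V) * y%:R))).
  by apply: ler_pM.
have -> : y%:R * (1000 * 100 * (q * V) * y%:R) = 1000 * 100 * q * W * y%:R ^+ (P0 + 7).
  by rewrite /V (_ : (P0 + 7 = (P0 + 5).+2)%N) ?exprSr; [ring | rewrite !addnS].
apply: le_trans (_ : _ <= 1000 * 100 * q * W *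
    ((a%:R * (2 / ln 2)) ^+ (P0 + 7) * ln n%:R ^+ (P0 + 7))) _.
  apply: ler_wpM2l => //; apply: mulr_ge0; last lra.
  by apply: mulr_ge0; [rewrite -natrM|lra].
by rewrite le_eqVlt; apply/orP; left; apply/eqP; rewrite -/W -/q; ring.
Qed.
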